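(* Fix \(n\geq 3\) and let \(f\) be extremal for \(M_n\). If \(\psi\in\mathrm{Hol}(\mathbb D)\) satisfies \(f\circ\psi=f\) in \(\mathbb D\), then \(\psi\in\mathrm{Aut}(\mathbb D)\). If \(N\geq 3\) then there exists \(a\in\mathbb D\) and an \(N\)th root of unity \(\xi\) such that \[ \psi(z)=\psi_{-a}(\xi\psi_{a}(z)),\qquad \psi_a(z)=\frac{z-a}{1-\overline{a}z}. \] In particular, \(\psi(a)=a\), and \(\psi^{\circ N}=\mathrm{id}\). If \(N=2\) then either \(\psi\) is of the form above, or \(\psi\) fixes \(\{\overline{\alpha_1},\overline{\alpha_2}\}\) and no other points in \(\overline{\mathbb D}\).
   Context: Let \(\mathcal B_0=\{f\in\mathrm{Hol}(\mathbb D)\;|\;0<|f|\leq 1\}\), and for \(f(z)=\sum_{j\geq 0}a_jz^j\in\mathcal B_0\) set \(M_n(f)=\mathrm{Re}\,a_n\). A function \(f\in\mathcal B_0\) (normalized so that \(f(0)>0\)) is called extremal for \(M_n\) if \(M_n(f)\geq M_n(F)\) for every \(F\in\mathcal B_0\). Any such extremal function has the form \[ f(z)=\exp\bigg(-\sum_{j=1}^N\lambda_j\frac{1+\alpha_jz}{1-\alpha_jz}\bigg) \] for some \(N\leq n\), weights \(\lambda_1,\dots,\lambda_N>0\), and distinct points \(\alpha_1,\dots,\alpha_N\in\partial\mathbb D\); \(N\) and \(\alpha_1,\dots,\alpha_N\) in the statement refer to this representation. \(\psi^{\circ N}\) denotes the \(N\)-fold composition of \(\psi\) with itself. *)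

(* Defs.v *)
(* MathComp-Analysis over R : realType, complex numbers R[i]
   from mathcomp-real-closed (a numFieldType, hence a normed space over itself,
   so [derivable f z 1] is complex differentiability). *)
From HB Require Import structures.
From mathcomp Require Import all_boot all_order all_algebra.
From mathcomp Require Import all_classical all_reals all_analysis.
From mathcomp Require Import complex.
Set Implicit Arguments. Unset Strict Implicit. Unset Printing Implicit Defensive.
Import Order.TTheory GRing.Theory Num.Theory.
Import numFieldTopology.Exports numFieldNormedType.Exports.
Local Open Scope ring_scope.
Local Open Scope complex_scope.

(* the complex numbers over R, seen as a numFieldType (so that the
   normed-space structure of MathComp-Analysis is found) *)
Definition Cx (R : realType) : numFieldType := R[i].

Section Defs.
Variable R : realType.
Local Notation C := (Cx R).

Definition disk : set C := [set z | `|z| < 1].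
Definition cdisk : set C := [set z | `|z| <= 1].

Definition holD (f : C -> C) : Prop := forall z, disk z -> derivable f z 1.

Definition B0 (f : C -> C) : Prop :=
  holD f /\ forall z, disk z -> 0 < `|f z| /\ `|f z| <= 1.

Definition taylor_coef (n : nat) (f : C -> C) : C :=
  derive1n n f 0 / (n`!)%:R.

Definition Mn (n : nat) (f : C -> C) : R := complex.Re (taylor_coef n f).

Definition extremal (n : nat) (f : C -> C) : Prop :=
  B0 f /\ 0 < f 0 /\ forall F, B0 F -> Mn n F <= Mn n f.

Definition cexp (z : C) : C :=
  ((expR (complex.Re z) * cos (complex.Im z)) +i* (expR (complex.Re z) * sin (complex.Im z)) : R[i]).

Definition mob (a : C) (z : C) : C := (z - a) / (1 - conjc a * z).

Definition is_aut (psi : C -> C) : Prop :=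
  holD psi /\ (forall z, disk z -> disk (psi z)) /\
  exists phi : C -> C, [/\ holD phi, (forall z, disk z -> disk (phi z)),
     (forall z, disk z -> phi (psi z) = z) & (forall z, disk z -> psi (phi z) = z)].

End Defs.

(* Main.v *)
(* Write [f = exp (- G)] with [G = \sum_j lam j * H_j], where [H_j] is the Herglotz
   kernel with pole [p_j], the conjugate of [alpha j]. Then [f o psi = f] gives
   [Re (G o psi) = Re G], hence [G o psi = G + tau]. As [z] tends to [p_j],
   [psi z] tends to a single pole [p_(s j)]. For every [i] the harmonic function
   [lam i * Re (H_i o psi) - \sum_(s j = i) lam j * Re H_j] has boundary value 0
   at every point of the circle, so it vanishes. Positivity of [Re (H_i o psi)]
   makes [s] surjective, hence bijective, so that
   [lam (s j) * H_(s j) o psi = lam j * H_j + constant]: [psi] is a Moebius map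
   permuting the poles. It has a fixed point in the closed disk. If one is
   interior, [psi] is conjugate to a rotation by some [xi], and taking the product
   of the rotated poles gives [xi ^ N = 1]. If one is on the circle, [psi] is
   affine in a half-plane coordinate and permutes finitely many boundary points;
   if two of these are finite, [psi] is the identity.

   No Cauchy theory is used. The maximum principle is proved by the second
   derivative test, available because [psi] inherits from [G] an expansion of
   order two away from the finitely many zeros of [G']. *)
Require Import Defs.
From HB Require Import structures.
From mathcomp Require Import all_boot all_order all_algebra.
From mathcomp Require Import fingroup perm.
From mathcomp Require Import all_classical all_reals all_analysis.
From mathcomp Require Import complex.
From mathcomp Require Import ring lra.
Import Order.TTheory GRing.Theory Num.Theory.
Import numFieldTopology.Exports numFieldNormedType.Exports.
Local Open Scope ring_scope.
Local Open Scope complex_scope.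
Local Open Scope classical_set_scope.

Set Implicit Arguments. Unset Strict Implicit. Unset Printing Implicit Defensive.

(* The norm of [Cx R] takes its values in [Cx R]; [md] is the real-valued modulus. *)
Local Notation md := ComplexField.Normc.normc.
Local Arguments ComplexField.Normc.normc : simpl never.

(** * The real-valued modulus on the complex numbers *)

Section Basics.
Context {R : realType}.
Local Notation C := (Cx R).
Implicit Types x y z w : C.

Lemma mdE z : `|z| = (md z)%:C. Proof. by []. Qed.
Lemma md_ge0 z : 0 <= md z.
Proof. by have := normr_ge0 z; rewrite mdE lecR. Qed.
Lemma mdM z w : md (z * w) = md z * md w. Proof. exact: ComplexField.Normc.normcM. Qed.
Lemma mdV z : md z^-1 = (md z)^-1. Proof. exact: ComplexField.Normc.normcV. Qed.
Lemma md_eq0 z : (md z == 0) = (z == 0).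
Proof. by rewrite -[RHS]normr_eq0 mdE -(inj_eq (@complexI R)). Qed.
Lemma mdD z w : md (z + w) <= md z + md w.
Proof. by have := ler_normD z w; rewrite !mdE -rmorphD lecR. Qed.
Lemma mdN z : md (- z) = md z.
Proof. by apply: complexI; rewrite -!mdE normrN. Qed.
Lemma mdBC z w : md (z - w) = md (w - z).
Proof. by rewrite -mdN opprB. Qed.
Lemma mdR (r : R) : md (r%:C : C) = `|r|.
Proof. by rewrite /md /= expr0n /= addr0 sqrtr_sqr. Qed.
Lemma md0 : md (0 : C) = 0.
Proof. exact: ComplexField.Normc.normc0. Qed.
Lemma md1 : md (1 : C) = 1.
Proof. exact: ComplexField.Normc.normc1. Qed.
Lemma mdX z n : md (z ^+ n) = md z ^+ n.
Proof. by apply: complexI; rewrite -mdE normrX mdE rmorphXn. Qed.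
Lemma mdJ z : md (conjc z) = md z.
Proof. by apply: complexI; rewrite -!mdE normcJ. Qed.
Lemma mulJ z : z * conjc z = (md z ^+ 2)%:C :> C.
Proof. by rewrite -sqr_normc mdE rmorphXn. Qed.
Lemma disk_md z : disk z = (md z < 1) :> Prop.
Proof. by rewrite /disk /= mdE -[1]/(1%:C) ltcR. Qed.
Lemma cdisk_md z : cdisk z = (md z <= 1) :> Prop.
Proof. by rewrite /cdisk /= mdE -[1]/(1%:C) lecR. Qed.
Lemma md1P z : (`|z| = 1) <-> md z = 1.
Proof. by rewrite mdE; split => [/(@complexI R _ 1)|->]. Qed.
Lemma md_Re z : `|complex.Re z| <= md z.
Proof. by have := normc_ge_Re z; rewrite mdE lecR. Qed.
Lemma md_sq z : md z ^+ 2 = complex.Re z ^+ 2 + complex.Im z ^+ 2.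
Proof. by case: z => a b; rewrite /md sqr_sqrtr //= addr_ge0 ?sqr_ge0. Qed.
Lemma conjcV_unit z : md z = 1 -> conjc z = z^-1.
Proof.
move=> h; have z0 : z != 0 by rewrite -md_eq0 h oner_eq0.
by apply: (mulfI z0); rewrite mulJ h expr1n mulfV.
Qed.
End Basics.

(** * Expansions of order one and two *)

Section Expansions.
Context {R : realType}.
Local Notation C := (Cx R).
Implicit Types (f g r : C -> C) (x y z w t : C).

(** The bound is non-strict and includes [t = 0], so no punctured neighbourhoods occur; for [k > 0]
    it forces [r 0 = 0]. *)
Definition little_o (k : nat) r := forall e : R, 0 < e ->
  exists2 d : R, 0 < d & forall t, md t < d -> md (r t) <= e * md t ^+ k.

Lemma little_o_ext k r s : r =1 s -> little_o k r -> little_o k s.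
Proof. by move=> /funext ->. Qed.

Lemma little_oD k r s : little_o k r -> little_o k s ->
  little_o k (fun t => r t + s t).
Proof.
move=> hr hs e e0; have e2 : 0 < e / 2 by rewrite divr_gt0.
have [d1 d10 h1] := hr _ e2; have [d2 d20 h2] := hs _ e2.
exists (Num.min d1 d2) => [|t]; rewrite lt_min ?d10 // => /andP[t1 t2].
apply: le_trans (mdD _ _) _; rewrite [e]splitr mulrDl.
by apply: lerD; [apply: h1|apply: h2].
Qed.

Lemma little_oZ k r c : little_o k r -> little_o k (fun t => c * r t).
Proof.
move=> hr e e0; have c1 : 0 < md c + 1 by rewrite ltr_wpDl ?md_ge0.
have [d d0 h] := hr _ (divr_gt0 e0 c1); exists d => // t /h ht.
rewrite mdM; apply: (@le_trans _ _ ((md c + 1) * md (r t))).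
  by rewrite ler_wpM2r ?md_ge0 // lerDl.
by rewrite mulrC -ler_pdivlMr // mulrAC.
Qed.

Lemma little_oN k r : little_o k r -> little_o k (fun t => - r t).
Proof. by move=> /(little_oZ (-1)); apply: little_o_ext => t; rewrite mulN1r. Qed.

Definition ex1 f z l := little_o 1 (fun t => f (z + t) - f z - l * t).

Definition ex2_with f z c1 c2 :=
  little_o 2 (fun t => f (z + t) - f z - c1 * t - c2 * t ^+ 2).

(** A Peano expansion, weaker than having a second derivative: it can be carried through
    compositions without differentiability of the first derivative. *)
Definition ex2 f z := exists c1 c2, ex2_with f z c1 c2.

Lemma derivable_ex1 f z : derivable f z 1 -> ex1 f z (derive1 f z).
Proof.
rewrite derive1E => df e e0.
have eC : 0 < (e%:C : C) by rewrite ltcR.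
have /cvgrPdist_le/(_ _ eC) := df.
rewrite /at_right -/(derive f z 1) /=.
move=> /nbhs_ballP[d /= d0 h].
have dE : d = (complex.Re d)%:C.
  by move: d0; case: (d) => a b; rewrite ltcE /= => /andP[/eqP -> _].
exists (complex.Re d) => [|t td].
  by move: d0; rewrite ltcE /= => /andP[_].
have [->|t0] := eqVneq t 0.
  by rewrite mulr0 subr0 addr0 subrr expr1 !md0 mulr0.
have : ball (0 : C) d t.
  by rewrite -ball_normE /ball_ /= sub0r normrN dE mdE ltcR.
move=> /h /(_ t0); rewrite mdE lecR expr1 => ht.
have mt : 0 < md t by rewrite lt_neqAle md_ge0 eq_sym md_eq0 t0.
rewrite -ler_pdivrMr //; apply: le_trans ht; rewrite -mdV -mdM -mdN le_eqVlt; apply/orP; left.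
apply/eqP; congr md; rewrite /GRing.scale /= mulr1 [t + z]addrC.
move: (derive _ _ _) => l; rewrite mulrBl opprB mulfK //; congr (_ - _); exact: mulrC.
Qed.

Lemma ex1_bound f z l : ex1 f z l -> exists2 d : R, 0 < d &
  forall t, md t < d -> md (f (z + t) - f z) <= (md l + 1) * md t.
Proof.
move=> /(_ 1 ltr01)[d d0 h]; exists d => // t /h; rewrite mul1r expr1 => ht.
rewrite -[f _ - f z](subrK (l * t)) mulrDl mul1r addrC.
by apply: le_trans (mdD _ _) _; rewrite mdM lerD2l.
Qed.

Lemma ex2_ex1 f z c1 c2 : ex2_with f z c1 c2 -> ex1 f z c1.
Proof.
move=> h e e0; have [d d0 hd] := h 1 ltr01.
have e1 : 0 < e / (md c2 + 1) by rewrite divr_gt0 // ltr_wpDl ?md_ge0.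
exists (Num.min d (e / (md c2 + 1))) => [|t]; rewrite lt_min ?d0 //.
move=> /andP[/hd {}hd t2]; rewrite expr1.
rewrite -[X in md X](subrK (c2 * t ^+ 2)).
apply: le_trans (mdD _ _) _; rewrite mdM mdX.
move: t2; rewrite ltr_pdivlMr ?ltr_wpDl ?md_ge0 // => t2.
have := md_ge0 t; have := md_ge0 c2; nra.
Qed.

Lemma ex1_small f z l : ex1 f z l -> forall e : R, 0 < e -> exists2 d : R, 0 < d &
  forall w, md (w - z) < d -> md (f w - f z) < e.
Proof.
move=> /ex1_bound[d d0 hd] e e0.
have M0 : 0 < md l + 1 by rewrite ltr_wpDl ?md_ge0.
exists (Num.min d (e / (md l + 1))) => [|w]; rewrite lt_min ?d0 ?divr_gt0 //.
move=> /andP[/hd]; rewrite [z + _]addrC subrK ltr_pdivlMr // mulrC => h1 h2.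
exact: le_lt_trans h1 h2.
Qed.

Lemma ex2_with0 z : ex2_with (fun=> 0) z 0 0.
Proof.
move=> e e0; exists 1 => // t _.
by rewrite !mul0r !subr0 md0 mulr_ge0 ?exprn_ge0 ?md_ge0 // ltW.
Qed.

Lemma ex2_withD f g z b c b' c' : ex2_with f z b c -> ex2_with g z b' c' ->
  ex2_with (fun x => f x + g x) z (b + b') (c + c').
Proof. by move=> h h'; apply: little_o_ext (little_oD h h') => t; ring. Qed.

Lemma ex2_withZ f z k b c : ex2_with f z b c ->
  ex2_with (fun x => k * f x) z (k * b) (k * c).
Proof. by move=> h; apply: little_o_ext (little_oZ k h) => t; ring. Qed.

Lemma ex2_with_sum (I : Type) (s : seq I) (P : pred I) (F : I -> C -> C) z (b c : I -> C) :
  (forall i, P i -> ex2_with (F i) z (b i) (c i)) ->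
  ex2_with (fun x => \sum_(i <- s | P i) F i x) z
    (\sum_(i <- s | P i) b i) (\sum_(i <- s | P i) c i).
Proof.
move=> h; elim: s => [|i s IH].
  rewrite !big_nil (_ : (fun _ => _) = fun=> 0); first exact: ex2_with0.
  by apply/funext => x; rewrite big_nil.
rewrite !big_cons; have [Pi|nPi] := boolP (P i); last first.
  by rewrite (_ : (fun _ => _) = fun x => \sum_(i <- s | P i) F i x) //;
    apply/funext => x; rewrite big_cons (negbTE nPi).
rewrite (_ : (fun _ => _) = fun x => F i x + \sum_(i <- s | P i) F i x).
  by apply: ex2_withD => //; exact: h.
by apply/funext => x; rewrite big_cons Pi.
Qed.

Lemma ex2D f g z : ex2 f z -> ex2 g z -> ex2 (fun x => f x + g x) z.
Proof. by move=> [b [c h]] [b' [c' h']]; exists (b + b'), (c + c'); exact: ex2_withD. Qed.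

Lemma ex2Z f z k : ex2 f z -> ex2 (fun x => k * f x) z.
Proof. by move=> [b [c h]]; exists (k * b), (k * c); exact: ex2_withZ. Qed.

(* [f (z + t) - f z] is [O(t)], so terms of order [k] in it are of order [k] in [t]. *)
Lemma little_o_comp k r f z l : ex1 f z l -> little_o k r ->
  little_o k (fun t => r (f (z + t) - f z)).
Proof.
move=> /ex1_bound[d d0 h] hr e e0; set M := md l + 1 in h.
have M0 : 0 < M by rewrite ltr_wpDl ?md_ge0.
have [d' d'0 hd'] := hr _ (divr_gt0 e0 (exprn_gt0 k M0)).
exists (Num.min d (d' / M)) => [|t]; rewrite lt_min ?d0 ?divr_gt0 //.
move=> /andP[/h ht]; rewrite ltr_pdivlMr // => t2.
have /hd' : md (f (z + t) - f z) < d'.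
  by apply: le_lt_trans ht _; rewrite mulrC.
move=> /le_trans; apply; rewrite -mulrA ler_pM2l //.
by rewrite mulrC ler_pdivrMr ?exprn_gt0 // mulrC -exprMn lerXn2r ?nnegrE ?mulr_ge0 ?md_ge0 // ltW.
Qed.

Lemma ex1_unique f z l l' : ex1 f z l -> ex1 f z l' -> l = l'.
Proof.
move=> h h'; apply/eqP; rewrite -subr_eq0; apply/negPn/negP => n0.
have m0 : 0 < md (l - l') by rewrite lt_neqAle md_ge0 eq_sym md_eq0 n0.
have [d d0 hd] := little_oD h (little_oN h') (divr_gt0 m0 (ltr0n R 2)).
have d2 : 0 < d / 2 by rewrite divr_gt0.
have : md ((d / 2)%:C : C) < d by rewrite mdR gtr0_norm // ltr_pdivrMr // ltr_pMr // ltr1n.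
move=> /hd; set t := _%:C => ht.
have E : f (z + t) - f z - l * t - (f (z + t) - f z - l' * t) = - ((l - l') * t) by ring.
move: ht; rewrite E mdN mdM expr1 mdR gtr0_norm // ler_pM2r //.
by move: m0; set m := md _; lra.
Qed.

(** The difference of squares factors into a term of order [o(t)] and a term of order [O(t)]. *)
Lemma little_o2_sqr f z l : ex1 f z l ->
  little_o 2 (fun t => (f (z + t) - f z) ^+ 2 - l ^+ 2 * t ^+ 2).
Proof.
move=> hf e e0; have [d d0 h] := ex1_bound hf.
set M := md l + 1 in h; have M0 : 0 < M by rewrite ltr_wpDl ?md_ge0.
have [d' d'0 h'] := hf _ (divr_gt0 e0 (ltr_wpDl (ltW M0) M0)).
exists (Num.min d d') => [|t]; rewrite lt_min ?d0 ?divr_gt0 //.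
move=> /andP[/h ht /h']; rewrite expr1 => ht'.
rewrite -exprMn subr_sqr mdM.
have h2 : md (f (z + t) - f z + l * t) <= (M + M) * md t.
  apply: le_trans (mdD _ _) _; rewrite mulrDl mdM lerD //.
  by rewrite ler_wpM2r ?md_ge0 // lerDl.
apply: le_trans (ler_pM (md_ge0 _) (md_ge0 _) ht' h2) _.
by rewrite mulrACA divfK ?gt_eqF // addr_gt0.
Qed.

Lemma ex2_comp f g z : ex2 g (f z) -> ex2 f z -> ex2 (fun x => g (f x)) z.
Proof.
move=> [a [b hg]] [c [d hf]]; have h1 := ex2_ex1 hf.
exists (a * c), (a * d + b * c ^+ 2).
have A := little_o_comp h1 hg.
have B := little_oD (little_oZ a hf) (little_oZ b (little_o2_sqr h1)).
by apply: little_o_ext (little_oD A B) => t /=; rewrite [f z + _]addrC subrK; ring.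
Qed.

(* Solve [g (f (z + t)) - g (f z) = a x + b x^2 + o(x^2)] for [x = f (z + t) - f z]. *)
Lemma ex2_cancel f g z l a b : ex1 f z l -> ex2_with g (f z) a b -> a != 0 ->
  ex2 (fun x => g (f x)) z -> ex2 f z.
Proof.
move=> hf hg a0 [c [d hgf]].
have A := little_oD hgf (little_oN (little_o_comp hf hg)).
have B := little_oD A (little_oN (little_oZ b (little_o2_sqr hf))).
exists (a^-1 * c), (a^-1 * (d - b * l ^+ 2)).
apply: little_o_ext (little_oZ a^-1 B) => t /=.
rewrite [f z + _]addrC subrK; field; exact: a0.
Qed.
End Expansions.

(** * A maximum principle *)

Section MaximumPrinciple.
Context {R : realType}.
Local Notation C := (Cx R).
Implicit Types (f g h : C -> C) (x y z w t : C).

Lemma md_le_Re_Im z : md z <= `|complex.Re z| + `|complex.Im z|.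
Proof.
rewrite -(@ler_pXn2r _ 2) ?nnegrE ?md_ge0 ?addr_ge0 ?normr_ge0 //.
rewrite md_sq sqrrD !real_normK ?num_real // -addrA lerD2l lerDr.
by rewrite mulrn_wge0 // mulr_ge0.
Qed.

Lemma md_le1 z : (md z <= 1) = (complex.Re z ^+ 2 + complex.Im z ^+ 2 <= 1).
Proof. by rewrite -md_sq -[LHS](@ler_pXn2r _ 2) ?nnegrE ?md_ge0 // expr1n. Qed.

(** Compactness comes from [R * R], where the closed disk is a closed subset of a product of two
    segments. *)
Lemma cdisk_EVT_max (v : C -> R) :
  (forall z, md z <= 1 -> forall e : R, 0 < e -> exists2 d : R, 0 < d &
     forall w, md w <= 1 -> md (w - z) < d -> `|v w - v z| < e) ->
  exists2 z, md z <= 1 & forall w, md w <= 1 -> v w <= v z.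
Proof.
move=> cv; pose g (p : R * R) := v (p.1 +i* p.2 : C).
pose A := [set p : R * R | p.1 ^+ 2 + p.2 ^+ 2 <= 1].
have AE (p : R * R) : A p <-> md (p.1 +i* p.2 : C) <= 1.
  by rewrite md_le1.
have Acl : closed A.
  rewrite (_ : A = (fun p : R * R => p.1 ^+ 2 + p.2 ^+ 2) @^-1` [set x | x <= 1]) //.
  apply: closed_comp; last exact: closed_le.
  by move=> p _ /=; apply: cvgD; apply: cvgM; do ?[exact: cvg_fst | exact: cvg_snd].
have Ac : compact A.
  apply: (subclosed_compact Acl (compact_setX (@segment_compact R (-1) 1) (@segment_compact R (-1) 1))).
  move=> [a b]; rewrite /A /= => ab; rewrite /= !in_itv /= -!ler_norml.
  split; rewrite -(@ler_pXn2r _ 2) ?nnegrE // real_normK ?num_real // expr1n.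
    by apply: le_trans ab; rewrite lerDl sqr_ge0.
  by apply: le_trans ab; rewrite lerDr sqr_ge0.
have A0 : A !=set0 by exists (0, 0); rewrite /A /= expr0n /= addr0 ler01.
have [|p] := compact_EVT_max (f := g) A0 Ac.
  apply/subspace_continuousP => p /AE Ap; apply/cvgrPdist_lt => e e0.
  have [d d0 hd] := cv _ Ap _ e0.
  rewrite near_withinE; have d2 : 0 < d / 2 by rewrite divr_gt0.
  near=> q => Aq; rewrite distrC; apply: hd; first exact/AE.
  apply: le_lt_trans (md_le_Re_Im _) _; rewrite [d]splitr /=.
  have : ball p (d / 2) q by near: q; exact: nbhsx_ballx.
  by case => /=; rewrite -!ball_normE /= => h1 h2; rewrite ltrD // distrC.
rewrite inE => /AE Ap pm; exists (p.1 +i* p.2) => // -[a b] ab.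
by apply: (pm (a, b)); rewrite inE; apply/AE.
Unshelve. all: by end_near. Qed.

Lemma ReM_le z w : `|complex.Re (z * w)| <= md z * md w.
Proof. by rewrite -mdM md_Re. Qed.

Lemma ReN z : complex.Re (- z) = - complex.Re z.
Proof. by case: z. Qed.

Lemma ReD z w : complex.Re (z + w) = complex.Re z + complex.Re w.
Proof. by case: z => a b; case: w. Qed.

Lemma mdD_sq z t : md (z + t) ^+ 2 = md z ^+ 2 + 2 * complex.Re (conjc z * t) + md t ^+ 2.
Proof. by rewrite !md_sq; case: z => a b; case: t => c d /=; ring. Qed.

(** Let [L] be the left-hand side of the conclusion. A step [t = r * conjc L] increases the function
    by about [2]-jet terms [r * md L ^+ 2 + k * md t ^+ 2], which contradicts maximality for small
    [r] unless [L = 0]. *)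
Lemma local_max_ex1 h (k : R) (eta l z0 : C) (d0 : R) : 0 < d0 -> 0 <= k ->
  ex1 h z0 l ->
  (forall t, md t < d0 ->
     complex.Re (h (z0 + t)) + k * md (z0 + t) ^+ 2 + complex.Re (eta * (z0 + t)) <=
     complex.Re (h z0) + k * md z0 ^+ 2 + complex.Re (eta * z0)) ->
  l + (2 * k)%:C * conjc z0 + eta = 0.
Proof.
move=> d00 k0 hh hm; apply/eqP; apply/negPn/negP; set L := _ + eta => L0.
have mL : 0 < md L by rewrite lt_neqAle md_ge0 eq_sym md_eq0 L0.
have [d1 d10 hd] := hh _ (divr_gt0 mL (ltr0n R 2)).
pose d := Num.min d0 d1; have dp : 0 < d by rewrite lt_min d00.
pose r := d / (2 * md L); have r0 : 0 < r by rewrite divr_gt0 // mulr_gt0.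
pose t : C := r%:C * conjc L.
have tE : md t = d / 2.
  by rewrite mdM mdR mdJ gtr0_norm // /r; field; rewrite gt_eqF.
have : md t < d by rewrite tE ltr_pdivrMr // ltr_pMr // ltr1n.
rewrite lt_min => /andP[/hm {}hm /hd]; rewrite expr1 => {}hd.
have := le_trans (md_Re _) hd; rewrite ler_norml => /andP[hd' _].
move: hm; rewrite mdD_sq.
have E : complex.Re (L * t) = r * md L ^+ 2.
  rewrite /t mulrCA mulJ -rmorphM /=; ring.
have : complex.Re (L * t) = complex.Re (l * t) + 2 * k * complex.Re (conjc z0 * t) + complex.Re (eta * t).
  by rewrite /L; case: (conjc z0) (l) (eta) (t) => [? ?] [? ?] [? ?] [? ?] /=; ring.
rewrite E !mulrDr !ReD; move: hd'; rewrite !ReD !ReN tE => hd' EE hm.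
have : r * md L ^+ 2 = md L * d / 2 by rewrite /r; field; rewrite gt_eqF.
have : 0 < md L * d by rewrite mulr_gt0.
have : 0 <= k * (d / 2) ^+ 2 by rewrite mulr_ge0 // sqr_ge0.
lra.
Qed.

(* Summing over [t = r, - r, i r, - i r] kills the harmonic part of order 2. *)
Lemma local_max_ex2 h (k : R) (eta z0 : C) (d0 : R) : 0 < d0 -> 0 < k ->
  ex2 h z0 ->
  ~ (forall t, md t < d0 ->
     complex.Re (h (z0 + t)) + k * md (z0 + t) ^+ 2 + complex.Re (eta * (z0 + t)) <=
     complex.Re (h z0) + k * md z0 ^+ 2 + complex.Re (eta * z0)).
Proof.
move=> d00 k0 [c1 [c2 hh]] hm.
have [d1 d10 hd] := hh _ (divr_gt0 k0 (ltr0n R 2)).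
pose d := Num.min d0 d1; have dp : 0 < d by rewrite lt_min d00.
pose r := d / 2; have r0 : 0 < r by rewrite divr_gt0.
have rd : r < d by rewrite ltr_pdivrMr // ltr_pMr // ltr1n.
(* Each direction [u] costs an error of [k / 2 * r ^+ 2]. In the sum over the four directions the
   terms in [c1], [c2], [z0] and [eta] cancel, leaving [2 * k * r ^+ 2 <= 0]. *)
have key (u t : C) : md u = 1 -> t = r%:C * u ->
  complex.Re (c1 * t) + complex.Re (c2 * t ^+ 2) - (k / 2) * r ^+ 2
  + k * (2 * complex.Re (conjc z0 * t) + r ^+ 2) + complex.Re (eta * t) <= 0.
  move=> u1 tu; have tE : md t = r by rewrite tu mdM mdR u1 mulr1 gtr0_norm.
  have : md t < d by rewrite tE.
  rewrite lt_min => /andP[/hm ht /hd hd'].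
  have := le_trans (md_Re _) hd'; rewrite ler_norml => /andP[+ _].
  by move: ht; rewrite mdD_sq !mulrDr !ReD !ReN tE; lra.
have mi : md ('i%C : C) = 1 by rewrite /md /= expr0n expr1n add0r sqrtr1.
have := key _ _ mi erefl; have := key (- 'i%C) _ _ erefl; rewrite mdN => /(_ mi).
have := key 1 _ md1 erefl; have := key (-1) _ _ erefl; rewrite mdN => /(_ md1).
have r2 : 0 < k * r ^+ 2 by rewrite mulr_gt0 // exprn_gt0.
move: (c1) (c2) (conjc z0) (eta) => [? ?] [? ?] [? ?] [? ?] /=.
by rewrite !expr2 /=; lra.
Qed.
End MaximumPrinciple.

Section MaximumPrinciple2.
Context {R : realType}.
Local Notation C := (Cx R).
Implicit Types (f g h : C -> C) (x y z w t : C).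

Lemma md_dist z w : `|md z - md w| <= md (z - w).
Proof.
rewrite ler_norml; have := mdD (z - w) w; have := mdD (w - z) z.
by rewrite !subrK mdBC; lra.
Qed.

(** Pigeonhole: the numbers [r / (i + 1)] for [i <= size s] are distinct, and there is one more of
    them than [s] has entries. *)
Lemma exists_small_notin (s : seq C) (r : R) : 0 < r ->
  exists2 eta : C, md eta <= r & eta \notin s.
Proof.
move=> r0; pose t := [seq (r / i.+1%:R)%:C : C | i <- iota 0 (size s).+1].
have tu : uniq t.
  rewrite map_inj_uniq ?iota_uniq // => i j /complexI /(mulfI (lt0r_neq0 r0)) /invr_inj.
  by move=> /eqP; rewrite eqr_nat => /eqP [].
have : ~~ all (mem s) t.
  apply/negP => /allP /(uniq_leq_size tu).
  by rewrite size_map size_iota ltnn.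
move=> /allPn[eta /mapP[i _ ->] es]; exists (r / i.+1%:R)%:C => //.
rewrite mdR ger0_norm; last by rewrite divr_ge0 // ltW.
by rewrite ler_pdivrMr // ler_peMr ?ler1n // ltW.
Qed.

(* A small linear perturbation keeps the maximum away from the finite set [E],
   where only the first derivative is under control. *)
Lemma max_principle h (E : seq C) :
  (forall z, md z < 1 -> derivable h z 1) ->
  (forall z, md z < 1 -> z \notin E -> ex2 h z) ->
  (forall z, md z = 1 -> forall e : R, 0 < e -> exists2 d : R, 0 < d &
     forall w, md w < 1 -> md (w - z) < d -> `|complex.Re (h w)| < e) ->
  forall z, md z < 1 -> complex.Re (h z) <= 0.
Proof.
move=> dh hE hb z1 z11; rewrite leNgt; apply/negP => m0.
(* With [m = 8 * k] and [md eta <= k], the perturbed function is at least [7 * k] at [z1] but at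
   most [2 * k] on the circle, so its maximum is interior. *)
set m := complex.Re _ in m0; pose k := m / 8; have k0 : 0 < k by rewrite divr_gt0.
(* The first-order condition at a maximum [e] in [E] would force [eta] to be the value listed for
   [e]. *)
pose bad := [seq - (derive1 h e + (2 * k)%:C * conjc e) | e <- E].
have [eta etak etab] := exists_small_notin bad k0.
(* The values of [h] on the circle are arbitrary; extending the real part by 0 gives a continuous
   function on the closed disk. *)
pose u z := if md z < 1 then complex.Re (h z) else 0.
pose v z := u z + k * md z ^+ 2 + complex.Re (eta * z).
have uc z : md z <= 1 -> forall e : R, 0 < e -> exists2 d : R, 0 < d &
     forall w, md w <= 1 -> md (w - z) < d -> `|u w - u z| < e.
  move=> z1' e e0; rewrite /u; have [zl|zg] := ltP (md z) 1.
    have [d d0 hd] := ex1_bound (derivable_ex1 (dh _ zl)); set M := md _ + 1 in hd.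
    have M0 : 0 < M by rewrite ltr_wpDl ?md_ge0.
    exists (Num.min (1 - md z) (Num.min d (e / M))).
      by rewrite !lt_min subr_gt0 zl d0 divr_gt0.
    move=> w _; rewrite !lt_min => /and3P[h1 h2 h3].
    have -> : md w < 1.
      by apply: le_lt_trans (_ : md (w - z) + md z < 1); [rewrite -[w in leLHS](subrK z) mdD|lra].
    have := hd _ h2; rewrite [z + _]addrC subrK => h4.
    rewrite -ReN -ReD; apply: le_lt_trans (md_Re _) _; apply: le_lt_trans h4 _.
    by rewrite mulrC -ltr_pdivlMr.
  have [d d0 hd] := hb z ltac:(by apply/eqP; rewrite eq_le z1' zg) e e0.
  exists d => // w _ wd; case: ifPn => wl; last by rewrite subr0 normr0.
  by rewrite subr0; apply: hd.
have [z z1' zm] : exists2 z, md z <= 1 & forall w, md w <= 1 -> v w <= v z.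
  apply: cdisk_EVT_max => z z1' e e0.
  have [d d0 hd] := uc _ z1' _ (divr_gt0 e0 (ltr0n R 2)).
  pose M := k + k + md eta + 1; have M0 : 0 < M by rewrite /M; have := md_ge0 eta; lra.
  exists (Num.min d (e / 2 / M)) => [|w w1]; rewrite lt_min ?d0 ?divr_gt0 //.
  move=> /andP[/(hd _ w1) h1]; rewrite ltr_pdivlMr // => h2.
  have -> : v w - v z = (u w - u z) + (k * ((md w - md z) * (md w + md z)) + complex.Re (eta * (w - z))).
    by rewrite mulrBr ReD ReN /v; ring.
  apply: le_lt_trans (ler_normD _ _) _; rewrite [e]splitr ltr_leD //.
  apply: le_trans (ler_normD _ _) _; apply: le_trans (ltW h2).
  have := ReM_le eta (w - z); have := md_dist w z; rewrite normrM (ger0_norm (ltW k0)) normrM.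
  have : `|md w + md z| <= 2 by rewrite ger0_norm ?addr_ge0 ?md_ge0 //; lra.
  have := normr_ge0 (md w - md z); have := normr_ge0 (md w + md z); have := md_ge0 (w - z).
  rewrite /M; move: (`|md w - md z|) (`|md w + md z|) (md (w - z)) => a b c c0 b0 a0 b2 ac.
  move=> h5; have : k * (a * b) <= k * (2 * c) by rewrite ler_wpM2l ?(ltW k0) //; nra.
  by nra.
have vz1 : v z1 <= v z by apply: zm; exact: ltW.
have mk : m = 8 * k by rewrite /k; field.
have vz1' : m - k <= v z1.
  rewrite /v /u z11 -/m.
  have := ReM_le eta z1; rewrite ler_norml => /andP[+ _].
  have : 0 <= k * md z1 ^+ 2 by rewrite mulr_ge0 ?sqr_ge0 ?ltW.
  have : md eta * md z1 <= k by apply: le_trans etak; rewrite ler_piMr ?md_ge0 // ltW.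
  lra.
have zl : md z < 1.
  rewrite ltNge; apply/negP => zg; have zE : md z = 1 by apply/eqP; rewrite eq_le z1' zg.
  move: vz1; rewrite {2}/v /u ltNge zg /= zE => vz1.
  have := ReM_le eta z; rewrite zE ler_norml => /andP[_ +].
  by move: vz1 vz1'; rewrite expr1n; lra.
have dz : 0 < 1 - md z by rewrite subr_gt0.
have hm t : md t < 1 - md z ->
     complex.Re (h (z + t)) + k * md (z + t) ^+ 2 + complex.Re (eta * (z + t)) <=
     complex.Re (h z) + k * md z ^+ 2 + complex.Re (eta * z).
  move=> ht; have tl : md (z + t) < 1 by apply: le_lt_trans (mdD _ _) _; lra.
  by have := zm _ (ltW tl); rewrite /v /u tl zl.
have [zE|zE] := boolP (z \in E); last by case: (local_max_ex2 (eta := eta) dz k0 (hE _ zl zE)); exact: hm.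
have := local_max_ex1 dz (ltW k0) (derivable_ex1 (dh _ zl)) hm.
rewrite addrC => /eqP; rewrite addr_eq0 => /eqP etaE.
by move/negP: etab; apply; apply/mapP; exists z.
Qed.

Lemma max_principle_eq0 h (E : seq C) :
  (forall z, md z < 1 -> derivable h z 1) ->
  (forall z, md z < 1 -> z \notin E -> ex2 h z) ->
  (forall z, md z = 1 -> forall e : R, 0 < e -> exists2 d : R, 0 < d &
     forall w, md w < 1 -> md (w - z) < d -> `|complex.Re (h w)| < e) ->
  forall z, md z < 1 -> complex.Re (h z) = 0.
Proof.
move=> dh hE hb z z1; apply/eqP; rewrite eq_le (max_principle dh hE hb) //=.
have -> : (0 <= complex.Re (h z)) = (complex.Re (- h z) <= 0) by rewrite ReN oppr_le0.
apply: (max_principle (h := fun z => - h z) (E := E)) z1 => [x /dh|x x1 /(hE _ x1)|x x1 e e0].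
- exact: derivableN.
- by move=> /(ex2Z (-1)); congr ex2; apply/funext => y; rewrite mulN1r.
- have [d d0 hd] := hb x x1 e e0; exists d => // w w1 /(hd _ w1).
  by rewrite ReN normrN.
Qed.

Lemma is_derive0_eps (phi : R -> R) (x : R) :
  (forall e : R, 0 < e -> exists2 d : R, 0 < d &
     forall t : R, `|t| < d -> `|phi (x + t) - phi x| <= e * `|t|) ->
  is_derive x 1 phi 0.
Proof.
move=> hp.
have cv : (fun t : R => t^-1 *: ((phi \o shift x) t%:A - phi x)) @ 0^' --> (0 : R).
  apply/cvgrPdist_le => e e0; have [d d0 hd] := hp _ e0.
  apply/nbhs_ballP; exists d => //= t; rewrite -ball_normE /= sub0r normrN => td t0.
  rewrite sub0r normrN /GRing.scale /= mulr1 normrM normfV mulrC ler_pdivrMr ?normr_gt0 //.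
  by rewrite [t + x]addrC; exact: hd.
by apply: DeriveDef; [apply/cvg_ex; exists 0 | exact: cvg_lim cv].
Qed.

End MaximumPrinciple2.

(** * Holomorphic functions with vanishing real part *)

Section ConstantRe.
Context {R : realType}.
Local Notation C := (Cx R).
Implicit Types (f g h : C -> C) (x y z w t : C).

(** A nonzero derivative [l] would change the real part along the direction [conjc l], so the
    derivative vanishes; the mean value theorem for the imaginary part along the radius to [z]
    concludes. *)
Lemma Re_eq0_const h :
  (forall z, md z < 1 -> derivable h z 1) ->
  (forall z, md z < 1 -> complex.Re (h z) = 0) ->
  forall z, md z < 1 -> h z = h 0.
Proof.
move=> dh h0.
have d0 z : md z < 1 -> derive1 h z = 0.
  move=> z1; apply/eqP/negPn/negP; set l := derive1 h z => l0.
  have ml : 0 < md l by rewrite lt_neqAle md_ge0 eq_sym md_eq0 l0.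
  have [d1 d10 hd] := derivable_ex1 (dh _ z1) (divr_gt0 ml (ltr0n R 2)).
  pose d := Num.min (1 - md z) d1; have dp : 0 < d by rewrite lt_min subr_gt0 z1.
  pose r := d / (2 * md l); have r0 : 0 < r by rewrite divr_gt0 // mulr_gt0.
  pose t : C := r%:C * conjc l.
  have tE : md t = r * md l by rewrite mdM mdR mdJ gtr0_norm.
  have : md t < d by rewrite tE /r invfM mulrA mulfVK ?gt_eqF // ltr_pdivrMr // ltr_pMr // ltr1n.
  rewrite lt_min => /andP[td /hd]; rewrite expr1 -/l => {}hd.
  have := le_trans (md_Re _) hd; rewrite !ReD !ReN h0 ?h0 //; last first.
    by apply: le_lt_trans (mdD _ _) _; lra.
  have -> : complex.Re (l * t) = r * md l ^+ 2 by rewrite /t mulrCA mulJ -rmorphM /=; ring.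
  have rl : 0 < r * md l ^+ 2 by rewrite mulr_gt0 // exprn_gt0.
  rewrite subrr sub0r normrN tE gtr0_norm //; lra.
move=> z z1; pose phi (x : R) := complex.Im (h (x%:C * z)).
have xz (x : R) : x \in `[0, 1]%R -> md (x%:C * z) < 1.
  rewrite in_itv /= => /andP[x0 x1]; rewrite mdM mdR ger0_norm //.
  by apply: le_lt_trans z1; rewrite ler_piMl ?md_ge0.
have dphi (x : R) : x \in `[0, 1]%R -> is_derive x 1 phi 0.
  move=> /xz x1; apply: is_derive0_eps => e e0.
  have M0 : 0 < md z + 1 by rewrite ltr_wpDl ?md_ge0.
  have [d dp hd] := derivable_ex1 (dh _ x1) (divr_gt0 e0 M0).
  exists (d / (md z + 1)) => [|t]; first by rewrite divr_gt0.
  rewrite ltr_pdivlMr // => ht.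
  have tz : md (t%:C * z) <= `|t| * (md z + 1).
    by rewrite mdM mdR ler_wpM2l // lerDl.
  have := hd _ (le_lt_trans tz ht); rewrite d0 // mul0r subr0 expr1 => h1.
  rewrite /phi; apply: (@le_trans _ _ (md (h (x%:C * z + t%:C * z) - h (x%:C * z)))).
    rewrite rmorphD /= mulrDl; set a := h _; set b := h _.
    have -> : complex.Im a - complex.Im b = - complex.Re ((a - b) * 'i%C).
      by case: (a) (b) => [? ?] [? ?] /=; ring.
    rewrite normrN; apply: le_trans (md_Re _) _.
    by rewrite mdM [md 'i%C]/md /= expr0n expr1n add0r sqrtr1 mulr1.
  apply: le_trans h1 _; rewrite mulrAC ler_pdivrMr // -mulrA ler_wpM2l //; exact: ltW.
have le01 : (0 : R) <= 1 by exact: ler01.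
have dphi' (x : R) : x \in `]0, 1[%R -> is_derive x 1 phi 0.
  by rewrite in_itv /= => /andP[x0 x1]; apply: dphi; rewrite in_itv /= !ltW.
have cphi : {within `[(0 : R), 1], continuous phi}.
  by apply: derivable_within_continuous => y /dphi [].
have [x _] := MVT_segment le01 dphi' cphi.
rewrite mul0r /phi mul1r mul0r => /subr0_eq I.
have := h0 z z1; have := h0 0; rewrite md0 => /(_ ltr01).
by move: I; case: (h z) (h 0) => [a b] [c d] /= -> -> ->.
Qed.
End ConstantRe.

(** * Herglotz kernels and their sums *)

Section Herglotz.
Context {R : realType}.
Local Notation C := (Cx R).
Implicit Types (a x y z w t : C).

Definition herglotz a z : C := (1 + a * z) / (1 - a * z).

Lemma md_1B_gt0 a z : md a = 1 -> md z < 1 -> 0 < md (1 - a * z).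
Proof.
move=> a1 z1; have := mdD (1 - a * z) (a * z).
by rewrite subrK md1 mdM a1 mul1r; lra.
Qed.

Lemma md_gt0P z : (0 < md z) = (z != 0).
Proof. by rewrite lt_neqAle md_ge0 andbT eq_sym md_eq0. Qed.

Lemma sub1_neq0 a z : md a = 1 -> md z < 1 -> 1 - a * z != 0.
Proof. by move=> a1 /(md_1B_gt0 a1); rewrite md_gt0P. Qed.

Lemma derivable_1B a z : derivable (fun x : C => 1 - a * x) z 1.
Proof.
apply: derivableB; first exact: derivable_cst.
by apply: derivableM; [exact: derivable_cst | exact: derivable_id].
Qed.

Lemma derivable_div (f g : C -> C) z : derivable f z 1 -> derivable g z 1 ->
  g z != 0 -> derivable (fun x => f x / g x) z 1.
Proof.
move=> df dg g0; have di := @derivableV C C g z 1 g0 dg.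
exact: (@derivableM C C f _ z 1 df di).
Qed.

Lemma derivable_herglotz_comp a (f : C -> C) z : derivable f z 1 ->
  1 - a * f z != 0 -> derivable (fun x => herglotz a (f x)) z 1.
Proof.
move=> df h; have daf : derivable (fun x : C => a * f x) z 1.
  by apply: derivableM; [exact: derivable_cst | exact: df].
have dn : derivable (fun x : C => 1 + a * f x) z 1.
  by apply: derivableD; [exact: derivable_cst | exact: daf].
have dd : derivable (fun x : C => 1 - a * f x) z 1.
  by apply: derivableB; [exact: derivable_cst | exact: daf].
exact: (derivable_div dn dd h).
Qed.

Lemma little_o2_cube (r : C -> C) (M d : R) : 0 < d ->
  (forall t, md t < d -> md (r t) <= M * md t ^+ 3) -> little_o 2 r.
Proof.
move=> d0 hr e e0; have M0 : 0 < `|M| + 1 by rewrite ltr_wpDl.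
exists (Num.min d (e / (`|M| + 1))) => [|t]; rewrite lt_min ?d0 ?divr_gt0 //.
move=> /andP[/hr]; rewrite ltr_pdivlMr // => ht h2; apply: le_trans ht _.
rewrite [md t ^+ 3]exprS mulrA ler_wpM2r ?exprn_ge0 ?md_ge0 //.
have := md_ge0 t; have := ler_norm M; nra.
Qed.

(** With [D = 1 - a * z] the remainder is exactly [2 * a ^+ 3 * t ^+ 3 / (D ^+ 3 * (D - a * t))],
    and [D - a * t] keeps modulus at least [md D / 2] for small [t]. *)
Lemma ex2_herglotz a z : 1 - a * z != 0 ->
  ex2_with (herglotz a) z (2 * a / (1 - a * z) ^+ 2) (2 * a ^+ 2 / (1 - a * z) ^+ 3).
Proof.
move=> D0; have mD : 0 < md (1 - a * z) by rewrite md_gt0P.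
set D := 1 - a * z in D0 mD *.
have ma : 0 < md a + 1 by rewrite ltr_wpDl ?md_ge0.
apply: (@little_o2_cube _ (4 * md a ^+ 3 / md D ^+ 4) (md D / 2 / (md a + 1))).
  by rewrite !divr_gt0.
move=> t; rewrite ltr_pdivlMr // => ht.
have hD : md D / 2 <= md (D - a * t).
  have := mdD (D - a * t) (a * t); rewrite subrK mdM.
  have : md a * md t <= md t * (md a + 1) by rewrite mulrC ler_wpM2l ?md_ge0 // lerDl.
  lra.
have Dt0 : D - a * t != 0 by rewrite -md_gt0P; apply: lt_le_trans hD; rewrite divr_gt0.
have -> : herglotz a (z + t) - herglotz a z - 2 * a / D ^+ 2 * t - 2 * a ^+ 2 / D ^+ 3 * t ^+ 2
  = 2 * a ^+ 3 * t ^+ 3 / (D ^+ 3 * (D - a * t)).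
  have E : D - a * t = 1 - a * (z + t) by rewrite /D; ring.
  move: Dt0; rewrite E /herglotz /D => Dt0; field.
  by rewrite Dt0 D0.
rewrite !(mdX, mdV, mdM).
have -> : md (2 : C) = 2 by rewrite -[2 in LHS](rmorph_nat (real_complex R)) mdR normr_nat.
rewrite [leRHS](_ : _ = 2 * md a ^+ 3 * md t ^+ 3 * (2 / md D ^+ 4)); last first.
  by field; rewrite gt_eqF.
rewrite ler_wpM2l //; first by rewrite !mulr_ge0 ?exprn_ge0 ?md_ge0.
rewrite [leRHS](_ : _ = (md D ^+ 3 * (md D / 2))^-1); last by field; rewrite gt_eqF.
rewrite lef_pV2 ?posrE ?mulr_gt0 ?exprn_gt0 ?divr_gt0 ?md_gt0P //.
by rewrite ler_wpM2l ?exprn_ge0 ?md_ge0.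
Qed.

(** Multiply numerator and denominator by the conjugate of the denominator. The result is the
    Poisson kernel: positive in the disk, zero on the circle away from the pole. *)
Lemma Re_herglotz a z : md a = 1 -> 1 - a * z != 0 ->
  complex.Re (herglotz a z) = (1 - md z ^+ 2) / md (1 - a * z) ^+ 2.
Proof.
move=> a1 D0; set D := 1 - a * z in D0 *.
have mD : md D ^+ 2 != 0 by rewrite expf_neq0 // md_eq0.
have -> : herglotz a z = ((md D ^+ 2)^-1)%:C * ((1 + a * z) * conjc D).
  rewrite fmorphV /= -mulJ /herglotz -/D; field.
  apply/andP; split; last exact: D0.
  by have : conjc D != 0 by rewrite conjc_eq0.
have -> : forall (r : R) w, complex.Re (r%:C * w : C) = r * complex.Re w.
  by move=> r [c d] /=; ring.
rewrite mulrC; congr (_ / _).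
have -> : 1 - md z ^+ 2 = 1 - md (a * z) ^+ 2 by rewrite mdM a1 mul1r.
by rewrite /D md_sq; case: (a * z) => u v /=; ring.
Qed.

Lemma Re_herglotz_gt0 a z : md a = 1 -> md z < 1 -> 0 < complex.Re (herglotz a z).
Proof.
move=> a1 z1; rewrite Re_herglotz ?sub1_neq0 // divr_gt0 //.
  by rewrite subr_gt0 exprn_ilt1 ?md_ge0.
by rewrite exprn_gt0 ?md_1B_gt0.
Qed.

(* Multiplying the sum by [\prod_i (1 - alpha i * z) ^+ 2] gives a polynomial
   that does not vanish at the conjugate of [alpha k]. *)
Lemma finite_zeros_sum_double_poles (N : nat) (c alpha : 'I_N -> C) :
  (0 < N)%N -> (forall j, c j != 0) -> (forall j, md (alpha j) = 1) ->
  injective alpha ->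
  exists E : seq C, forall z, md z < 1 -> z \notin E ->
    \sum_(j < N) c j / (1 - alpha j * z) ^+ 2 != 0.
Proof.
move=> N0 c0 a1 ai.
pose Q : {poly R[i]} := \sum_(j < N) (c j)%:P * \prod_(i < N | i != j) (1 - (alpha i)%:P * 'X) ^+ 2.
have QE z : Q.[z] = \sum_(j < N) c j * \prod_(i < N | i != j) (1 - alpha i * z) ^+ 2.
  rewrite /Q horner_sum; apply: eq_bigr => j _; rewrite hornerM hornerC horner_prod.
  by congr (_ * _); apply: eq_bigr => i _; rewrite !hornerE.
have Q0 : Q != 0.
  pose k := Ordinal N0; apply/eqP => Q0; have := QE (conjc (alpha k)).
  rewrite Q0 horner0 (bigD1 k) //= [X in _ + X]big1 ?addr0 => [|j jk].
    move/esym/eqP; rewrite mulf_eq0 (negbTE (c0 _)) /= => /prodf_eq0[i ik].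
    rewrite expf_eq0 /= subr_eq0 conjcV_unit // => /eqP /esym /divr1_eq /ai ik'.
    by rewrite ik' eqxx in ik.
  rewrite (bigD1 k) 1?eq_sym //= mulJ a1 expr1n subrr expr0n /= mul0r mulr0 //.
have [s sE] := closed_field_poly_normal Q; exists s => z z1 zs.
apply/eqP => S0; have : Q.[z] == 0.
  rewrite QE; apply/eqP.
  transitivity ((\sum_(j < N) c j / (1 - alpha j * z) ^+ 2) *
                \prod_i (1 - alpha i * z) ^+ 2).
    rewrite mulr_suml; apply: eq_bigr => j _.
    by rewrite [in RHS](bigD1 j) //= mulrA divfK // expf_neq0 // sub1_neq0.
  by rewrite S0 mul0r.
rewrite sE hornerZ mulf_eq0 lead_coef_eq0 (negbTE Q0) /= horner_prod prodf_seq_eq0.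
by case/hasP => x xs /=; rewrite hornerXsubC subr_eq0 => /eqP zx; rewrite zx xs in zs.
Qed.
End Herglotz.

(** * Behaviour of [psi] near the poles, and the permutation it induces *)

Section BoundaryBehaviour.
Context {R : realType}.
Local Notation C := (Cx R).
Implicit Types (a x y z w t : C).

Lemma uniform_lower_bound (I : finType) (P : pred I) (F : I -> R) :
  (forall i, P i -> 0 < F i) -> exists2 m : R, 0 < m & forall i, P i -> m <= F i.
Proof.
move=> F0; suff [m m0 hm] : exists2 m : R, 0 < m & forall i, i \in enum I -> P i -> m <= F i.
  by exists m => // i; apply: hm; rewrite mem_enum.
elim: (enum I) => [|i s [m m0 hm]]; first by exists 1.
have [Pi|nPi] := boolP (P i); last first.
  by exists m => // k; rewrite inE => /orP[/eqP->|/hm//]; rewrite (negbTE nPi).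
exists (Num.min m (F i)) => [|k]; first by rewrite lt_min m0 F0.
rewrite inE ge_min => /orP[/eqP-> _|/hm h /h ->//]; by rewrite lexx orbT.
Qed.

Variables (N : nat) (lam : 'I_N -> R) (alpha : 'I_N -> C).
Hypothesis lam_gt0 : forall j, 0 < lam j.
Hypothesis md_alpha : forall j, md (alpha j) = 1.
Hypothesis alpha_inj : injective alpha.

Implicit Types (P : pred 'I_N) (f : C -> C).

Local Notation pole j := (conjc (alpha j) : C).

(** The predicate lets the full sum, the sum without one pole, a single term and the sum over a
    fibre of [s] be handled by the same lemmas. *)
Definition herglotz_sum P z : C :=
  \sum_(j < N | P j) (lam j)%:C * herglotz (alpha j) z.

Lemma md_pole j : md (pole j) = 1.
Proof. by rewrite mdJ. Qed.

Lemma md_sub_pole j z : md (1 - alpha j * z) = md (z - pole j).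
Proof.
rewrite -[RHS]mul1r -(md_alpha j) -mdM mulrBr mulJ md_alpha expr1n /= mdBC //.
Qed.

Lemma sub_pole_neq0 j z : z != pole j -> 1 - alpha j * z != 0.
Proof. by rewrite -subr_eq0 -!md_eq0 md_sub_pole. Qed.

Lemma ReZ (r : R) z : complex.Re (r%:C * z : C) = r * complex.Re z.
Proof. by case: z => c d /=; ring. Qed.

Lemma Re_sum (I : Type) (s : seq I) (P : pred I) (F : I -> C) :
  complex.Re (\sum_(i <- s | P i) F i) = \sum_(i <- s | P i) complex.Re (F i).
Proof. exact: (big_morph _ ReD). Qed.

Lemma ex2_herglotz_sum P z : (forall j, P j -> z != pole j) ->
  exists2 c2, ex2_with (herglotz_sum P) z
    (\sum_(j < N | P j) (lam j)%:C * (2 * alpha j / (1 - alpha j * z) ^+ 2)) c2 &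
    ex2 (herglotz_sum P) z.
Proof.
move=> h; have E := ex2_with_sum (index_enum 'I_N) (fun j Pj =>
  ex2_withZ (lam j)%:C (ex2_herglotz (sub_pole_neq0 (h j Pj)))).
by eexists; [exact: E | do 2!eexists; exact: E].
Qed.

Lemma Re_herglotz_sum_ge0 P z : md z < 1 -> 0 <= complex.Re (herglotz_sum P z).
Proof.
move=> z1; rewrite Re_sum sumr_ge0 // => j _.
by rewrite ReZ mulr_ge0 ?(ltW (lam_gt0 _)) // ltW // Re_herglotz_gt0.
Qed.

Lemma Re_herglotz_sum_boundary P z : md z = 1 -> (forall j, P j -> z != pole j) ->
  complex.Re (herglotz_sum P z) = 0.
Proof.
move=> z1 h; rewrite Re_sum big1 // => j Pj.
by rewrite ReZ Re_herglotz ?sub_pole_neq0 ?h // z1 expr1n subrr mul0r mulr0.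
Qed.

(** A one-sided bound suffices, since inside the disk the real part is nonnegative by
    [Re_herglotz_sum_ge0]. *)
Lemma Re_herglotz_sum_small P z : md z = 1 -> (forall j, P j -> z != pole j) ->
  forall e : R, 0 < e -> exists2 d : R, 0 < d &
  forall w, md (w - z) < d -> complex.Re (herglotz_sum P w) < e.
Proof.
move=> z1 h e e0; have [c2 /ex2_ex1 /ex1_small/(_ _ e0)[d d0 hd] _] := ex2_herglotz_sum h.
exists d => // w /hd; have := md_Re (herglotz_sum P w - herglotz_sum P z).
rewrite ReD ReN (Re_herglotz_sum_boundary z1 h) subr0 ler_norml => /andP[_].
exact: le_lt_trans.
Qed.

Lemma pole_neq j k : k != j -> pole j != pole k.
Proof. by apply: contraNneq => /(can_inj (@conjcK R)) /alpha_inj ->. Qed.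

Lemma herglotz_sumD1 j z :
  herglotz_sum xpredT z = (lam j)%:C * herglotz (alpha j) z + herglotz_sum (predC1 j) z.
Proof. by rewrite /herglotz_sum (bigD1 j). Qed.

Lemma derivable_herglotz_sum_comp (P : pred 'I_N) (f : C -> C) z : derivable f z 1 -> md (f z) < 1 ->
  derivable (fun x => herglotz_sum P (f x)) z 1.
Proof.
move=> df fz; rewrite (_ : (fun _ => _) =
   \sum_(j < N) (fun x => if P j then (lam j)%:C * herglotz (alpha j) (f x) else 0)); last first.
  by apply/funext => x; rewrite fct_sumE /herglotz_sum big_mkcond.
apply: derivable_sum => j; case: (P j); last exact: derivable_cst.
apply: (@derivableM C C (fun=> _) _ z 1); first exact: derivable_cst.
by apply: derivable_herglotz_comp => //; rewrite sub1_neq0.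
Qed.

Variable psi : C -> C.
Hypothesis psi_derivable : forall z, md z < 1 -> derivable psi z 1.
Hypothesis psi_disk : forall z, md z < 1 -> md (psi z) < 1.
Hypothesis Re_psi : forall z, md z < 1 ->
  complex.Re (herglotz_sum xpredT (psi z)) = complex.Re (herglotz_sum xpredT z).

Lemma herglotz_sum_psi : exists tau : C, forall z, md z < 1 ->
  herglotz_sum xpredT (psi z) = herglotz_sum xpredT z + tau.
Proof.
pose h z : C := herglotz_sum xpredT (psi z) - herglotz_sum xpredT z.
have dh w : md w < 1 -> derivable h w 1.
  move=> w1; apply: (@derivableB C C C).
    by apply: derivable_herglotz_sum_comp; [exact: psi_derivable | exact: psi_disk].
  by apply: (@derivable_herglotz_sum_comp _ id) => //; exact: derivable_id.
have h0 w : md w < 1 -> complex.Re (h w) = 0.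
  by move=> w1; rewrite /h ReD ReN Re_psi // subrr.
exists (h 0) => z z1; rewrite -(Re_eq0_const dh h0 z1) /h addrC subrK //.
Qed.

(** Both [G] and [G o psi = G + tau] have expansions of order two, so [ex2_cancel] gives one for
    [psi] wherever the derivative of [G] at [psi z] is nonzero. By the chain rule that can fail only
    at a zero of the derivative of [G] at [z], and [E] contains all these zeros. *)
Lemma ex2_psi : (0 < N)%N ->
  exists E : seq C, forall z, md z < 1 -> z \notin E -> ex2 psi z.
Proof.
move=> N0; have c0 j : ((lam j)%:C * (2 * alpha j)) != 0 :> C.
  rewrite !mulf_neq0 ?pnatr_eq0 //.
    by rewrite -md_eq0 mdR normr_eq0 gt_eqF.
  by rewrite -md_eq0 md_alpha oner_eq0.
have [E hE] := finite_zeros_sum_double_poles N0 c0 md_alpha alpha_inj.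
exists E => z z1 zE; have [tau htau] := herglotz_sum_psi.
have off w : md w < 1 -> forall j, xpredT j -> w != pole j.
  by move=> w1 j _; apply: contraTneq w1 => ->; rewrite md_pole ltxx.
have [b ab _] := ex2_herglotz_sum (off _ z1).
have [b' ab' _] := ex2_herglotz_sum (off _ (psi_disk z1)).
move: (ex2_ex1 ab) (ex2_ex1 ab'); set a := \sum_(j < N) _ in ab *.
set a' := \sum_(j < N) _ in ab' * => a1 a1'.
have aE : a = \sum_(j < N) ((lam j)%:C * (2 * alpha j)) / (1 - alpha j * z) ^+ 2.
  by apply: eq_bigr => j _; rewrite !mulrA.
have dpsi := derivable_ex1 (psi_derivable z1).
pose G := herglotz_sum xpredT.
(* The constant [tau] cancels in increments, so an expansion of [G] at [z] is also one of [G o psi],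
   as long as [z + t] stays in the disk. *)
have shift (k : nat) (p q : C) :
    little_o k (fun t => G (z + t) - G z - p * t - q * t ^+ 2) ->
    little_o k (fun t => G (psi (z + t)) - G (psi z) - p * t - q * t ^+ 2).
  move=> h e e0; have [d d0 hd] := h _ e0.
  exists (Num.min d (1 - md z)) => [|t]; rewrite lt_min ?d0 ?subr_gt0 //.
  move=> /andP[/hd + t2]; rewrite /G !htau //; last by apply: le_lt_trans (mdD _ _) _; lra.
  by have -> : forall x y : C, x + tau - (y + tau) = x - y by move=> x y; ring.
apply: (@ex2_cancel R psi (herglotz_sum xpredT) z _ a' b' dpsi ab'); last first.
  by exists a, b; apply: (shift 2%N); exact: ab.
apply/eqP => a'0; have := hE _ z1 zE; rewrite -aE => /eqP; apply.
have h1 : ex1 (fun x => herglotz_sum xpredT (psi x)) z a.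
  apply: little_o_ext (shift 1%N a 0 _) => [t|]; first by rewrite mul0r subr0.
  by apply: little_o_ext a1 => t; rewrite mul0r subr0.
apply: (ex1_unique h1).
have := little_o_comp dpsi a1'; apply: little_o_ext => t.
by rewrite a'0 !mul0r !subr0 [psi z + _]addrC subrK.
Qed.

(** If [psi z] kept distance [rho] from all poles, [G (psi z)] would be bounded by a constant,
    whereas [G z] blows up as [z] tends to the pole; they differ only by [tau]. *)
Lemma psi_near_pole j (rho : R) : 0 < rho -> exists2 d : R, 0 < d &
  forall z, md z < 1 -> md (z - pole j) < d -> exists i, md (psi z - pole i) < rho.
Proof.
move=> rho0; have [tau htau] := herglotz_sum_psi.
have [c2 /ex2_ex1 /ex1_small/(_ _ ltr01)[d0 d00 hd0] _] :=
  @ex2_herglotz_sum (predC1 j) (pole j) (fun k kj => pole_neq kj).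
pose S := \sum_(i < N) lam i * (2 / rho).
have S0 : 0 <= S by rewrite sumr_ge0 // => i _; rewrite mulr_ge0 ?ltW ?divr_gt0.
(* [S] bounds [G (psi z)] through [2 / rho] for each kernel; the final 1 bounds the variation of the
   other kernels near [pole j]. *)
pose M := S + md tau + md (herglotz_sum (predC1 j) (pole j)) + 1.
have M0 : 0 < M by rewrite ltr_wpDl // !addr_ge0 ?md_ge0.
exists (Num.min d0 (Num.min 1 (lam j / M))); first by rewrite !lt_min d00 ltr01 divr_gt0.
move=> z z1; rewrite !lt_min => /and3P[/hd0 h1 h2 h3].
apply: contrapT => no; have far i : rho <= md (psi z - pole i).
  by rewrite leNgt; apply/negP => hi; apply: no; exists i.
have up : md (herglotz_sum xpredT (psi z)) <= S.
  apply: (@le_trans _ _ (\sum_(i < N) md ((lam i)%:C * herglotz (alpha i) (psi z)))).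
    rewrite /herglotz_sum; elim/big_ind2: _ => [|x x' y y' hx hy|//]; first by rewrite md0.
    by apply: le_trans (mdD _ _) _; apply: lerD.
  apply: ler_sum => i _; rewrite mdM mdR gtr0_norm // ler_pM2l // mdM mdV md_sub_pole.
  apply: ler_pM; rewrite ?invr_ge0 ?md_ge0 //.
    apply: le_trans (mdD _ _) _; rewrite md1 mdM md_alpha mul1r.
    by have := psi_disk z1; lra.
  by rewrite lef_pV2 ?posrE //; exact: lt_le_trans (far i).
have D0 : 0 < md (z - pole j) by rewrite -md_sub_pole md_1B_gt0.
(* The numerator of the kernel has modulus at least [2 - md (z - pole j)], hence at least 1 here. *)
have low : lam j / md (z - pole j) <= md ((lam j)%:C * herglotz (alpha j) z).
  rewrite mdM mdR gtr0_norm // ler_pM2l // mdM mdV md_sub_pole ler_peMl ?invr_ge0 ?(ltW D0) //.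
  have := mdD (1 + alpha j * z) (1 - alpha j * z).
  rewrite (_ : 1 + alpha j * z + (1 - alpha j * z) = 2%:R); last by ring.
  rewrite md_sub_pole -[2%:R in leLHS](rmorph_nat (real_complex R)) mdR normr_nat.
  lra.
have big : M < lam j / md (z - pole j) by rewrite ltr_pdivlMr // mulrC -ltr_pdivlMr.
have : md ((lam j)%:C * herglotz (alpha j) z) <=
   md (herglotz_sum xpredT (psi z)) + md tau + md (herglotz_sum (predC1 j) (pole j)) +
   md (herglotz_sum (predC1 j) z - herglotz_sum (predC1 j) (pole j)).
  have -> : (lam j)%:C * herglotz (alpha j) z =
      herglotz_sum xpredT (psi z) - tau - herglotz_sum (predC1 j) (pole j) -
      (herglotz_sum (predC1 j) z - herglotz_sum (predC1 j) (pole j)).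
    by rewrite htau // (herglotz_sumD1 j); ring.
  have mdB x y : md (x - y) <= md x + md y by rewrite -(mdN y) mdD.
  apply: le_trans (mdB _ _) _; rewrite lerD2r.
  by apply: le_trans (mdB _ _) _; rewrite lerD2r mdB.
by move: up low big h1; rewrite /M; lra.
Qed.

(** Connectedness: the part of the disk near [pole j] is convex, and there [psi] takes values in
    disjoint small balls around the poles. By the intermediate value theorem on segments from a base
    point [z0], only one ball is visited. *)
Lemma psi_pole_limit j : exists i, forall rho : R, 0 < rho -> exists2 d : R, 0 < d &
  forall z, md z < 1 -> md (z - pole j) < d -> md (psi z - pole i) < rho.
Proof.
have [s s0 hs] : exists2 s : R, 0 < s & forall i k, i != k -> s <= md (pole i - pole k).
  have [|s s0 hs] := @uniform_lower_bound ('I_N * 'I_N)%type (fun p => p.1 != p.2)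
     (fun p => md (pole p.1 - pole p.2)).
    by move=> p; rewrite md_gt0P subr_eq0 eq_sym => /pole_neq; rewrite eq_sym.
  by exists s => // i k /(hs (i, k)).
(* With [r = s / 3], a point at distance exactly [r] from one pole is within [r] of no pole. *)
pose r := s / 3; have r0 : 0 < r by rewrite divr_gt0.
have [d0 d00 hd0] := psi_near_pole j r0.
pose d1 := Num.min d0 1; have d10 : 0 < d1 by rewrite lt_min d00 ltr01.
have [d1d d11] : d1 <= d0 /\ d1 <= 1 by rewrite !ge_min !lexx orbT.
pose z0 : C := (1 - d1 / 2)%:C * pole j.
have z01 : md z0 < 1.
  by rewrite mdM mdR md_pole mulr1 ger0_norm; lra.
have z0d : md (z0 - pole j) < d0.
  have -> : z0 - pole j = (- (d1 / 2))%:C * pole j.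
    by rewrite /z0 rmorphB rmorphN rmorph1 /=; ring.
  by rewrite mdM md_pole mulr1 mdR normrN ger0_norm; lra.
have [i hi] := hd0 _ z01 z0d.
exists i => rho rho0.
have rr0 : 0 < Num.min rho r by rewrite lt_min rho0.
have [d2 d20 hd2] := psi_near_pole j rr0.
exists (Num.min d1 d2) => [|z z1]; rewrite lt_min ?d10 //.
move=> /andP[zd1 /(hd2 _ z1)[k]]; rewrite lt_min => /andP[hk hkr].
suff <- : k = i by [].
apply/eqP/negPn/negP => ki.
(* If [psi z] were near another pole [k], then [phi] would pass from below [r] to above [r] and
   hence take the forbidden value [r]. *)
pose q (t : R) : C := z0 + t%:C * (z - z0); pose phi (t : R) := md (psi (q t) - pole i).
have qE (t : R) w : q t - w = (1 - t)%:C * (z0 - w) + t%:C * (z - w).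
  by rewrite /q rmorphB /=; ring.
have qlt (w : C) (c t : R) : t \in `[0, 1]%R -> md (z0 - w) < c -> md (z - w) < c -> md (q t - w) < c.
  rewrite in_itv /= => /andP[t0 t1] h0 h1; rewrite qE; apply: le_lt_trans (mdD _ _) _.
  rewrite !mdM !mdR (ger0_norm t0) ger0_norm ?subr_ge0 //.
  have [->|tn0] := eqVneq t 0; first by rewrite subr0 mul1r mul0r addr0.
  have tp : 0 < t by rewrite lt_neqAle eq_sym tn0.
  have : (1 - t) * md (z0 - w) <= (1 - t) * c by rewrite ler_wpM2l ?subr_ge0 // ltW.
  have : t * md (z - w) < t * c by rewrite ltr_pM2l.
  lra.
have q1 (t : R) : t \in `[0, 1]%R -> md (q t) < 1.
  by move=> t01; have := @qlt 0 1 t t01; rewrite !subr0; apply.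
have qd (t : R) : t \in `[0, 1]%R -> md (q t - pole j) < d0.
  by move=> t01; apply: qlt => //; apply: lt_le_trans d1d.
have cphi : {within `[(0 : R), 1], continuous phi}.
  apply/subspace_continuousP => t t01; apply/cvgrPdist_lt => e e0.
  have [d dp hd] := ex1_small (derivable_ex1 (psi_derivable (q1 _ t01))) e0.
  have M0 : 0 < md (z - z0) + 1 by rewrite ltr_wpDl ?md_ge0.
  rewrite near_withinE; apply/nbhs_ballP; exists (d / (md (z - z0) + 1)) => /=; first by rewrite divr_gt0.
  move=> u; rewrite -ball_normE /= ltr_pdivlMr // => hu _.
  apply: le_lt_trans (md_dist _ _) _.
  have -> : psi (q t) - pole i - (psi (q u) - pole i) = psi (q t) - psi (q u) by ring.
  rewrite mdBC; apply: hd; rewrite /q.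
  have -> : z0 + u%:C * (z - z0) - (z0 + t%:C * (z - z0)) = (u - t)%:C * (z - z0).
    by rewrite rmorphB /=; ring.
  rewrite mdM mdR distrC; apply: le_lt_trans hu.
  by rewrite ler_wpM2l // lerDl.
have le01 : (0 : R) <= 1 by exact: ler01.
have phi0 : phi 0 < r by rewrite /phi /q mul0r addr0.
have phi1 : r < phi 1.
  have -> : phi 1 = md (psi z - pole i) by rewrite /phi /q mul1r [z0 + _]addrC subrK.
  have := mdD (pole k - psi z) (psi z - pole i); rewrite addrA subrK mdBC.
  have := hs _ _ ki; have : s = 3 * r by rewrite /r; field.
  lra.
have rb : Num.min (phi 0) (phi 1) <= r <= Num.max (phi 0) (phi 1).
  by rewrite ge_min (ltW phi0) le_max (ltW phi1) orbT.
have [c c01 phic] := IVT le01 cphi rb.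
have [k' hk'] := hd0 _ (q1 _ c01) (qd _ c01).
have [k'i|k'i] := eqVneq k' i.
  by move: hk'; rewrite k'i -/(phi c) phic ltxx.
have := hs _ _ k'i; have := mdD (pole k' - psi (q c)) (psi (q c) - pole i).
rewrite addrA subrK [md (pole k' - _)]mdBC -/(phi c) phic.
have : s = 3 * r by rewrite /r; field.
lra.
Qed.

Lemma herglotz_sum_pred1 i z :
  herglotz_sum (pred1 i) z = (lam i)%:C * herglotz (alpha i) z.
Proof. by rewrite /herglotz_sum big_pred1_eq. Qed.

Lemma Re_herglotz_sum_le (P Q : pred 'I_N) z : md z < 1 -> (forall j, P j -> Q j) ->
  complex.Re (herglotz_sum P z) <= complex.Re (herglotz_sum Q z).
Proof.
move=> z1 PQ; rewrite !Re_sum big_mkcond [leRHS]big_mkcond; apply: ler_sum => j _.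
have Hj : 0 <= complex.Re ((lam j)%:C * herglotz (alpha j) z).
  by rewrite ReZ mulr_ge0 ?(ltW (lam_gt0 _)) // ltW // Re_herglotz_gt0.
by case: ifP => [/PQ ->|_]; last case: ifP.
Qed.

(** Away from the poles both terms lie between 0 and the real part of [G], which tends to 0. At a
    pole the singular terms are compared through [Re_psi], and everything else tends to 0. *)
Lemma fiber_herglotz_small (s : 'I_N -> 'I_N) i :
  (forall j, forall rho : R, 0 < rho -> exists2 d : R, 0 < d &
    forall z, md z < 1 -> md (z - pole j) < d -> md (psi z - pole (s j)) < rho) ->
  forall z, md z = 1 -> forall e : R, 0 < e -> exists2 d : R, 0 < d &
     forall w, md w < 1 -> md (w - z) < d ->
     `|complex.Re (herglotz_sum (pred1 i) (psi w) - herglotz_sum (fun j => s j == i) w)| < e.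
Proof.
move=> hs z z1 e e0.
have [/existsP[j /eqP zj]|nz] := boolP [exists j, z == pole j]; last first.
  have zp j : xpredT j -> z != pole j.
    by move=> _; apply: contra nz => zj; apply/existsP; exists j.
  have [d d0 hd] := Re_herglotz_sum_small z1 zp e0.
  exists d => // w w1 /hd hw; rewrite ReD ReN ltr_norml.
  have := Re_herglotz_sum_ge0 (pred1 i) (psi_disk w1).
  have := Re_herglotz_sum_ge0 (fun j => s j == i) w1.
  have := @Re_herglotz_sum_le (pred1 i) xpredT _ (psi_disk w1) (fun _ _ => isT).
  have := @Re_herglotz_sum_le (fun j => s j == i) xpredT _ w1 (fun _ _ => isT).
  rewrite Re_psi //; lra.
have e2 : 0 < e / 2 by rewrite divr_gt0.
have [d1 d10 hd1] := Re_herglotz_sum_small (md_pole j) (P := predC1 j) (fun k kj => pole_neq kj) e2.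
have [d2 d20 hd2] := Re_herglotz_sum_small (md_pole (s j)) (P := predC1 (s j)) (fun k kj => pole_neq kj) e2.
have [d3 d30 hd3] := hs j _ d20.
exists (Num.min d1 d3) => [|w w1]; rewrite lt_min ?d10 // zj => /andP[/hd1 A /(hd3 _ w1)/hd2 B].
have pw1 := psi_disk w1.
have := Re_psi w1; rewrite (herglotz_sumD1 (s j)) (herglotz_sumD1 j) !ReD -!herglotz_sum_pred1 => XY.
have B0 := Re_herglotz_sum_ge0 (predC1 (s j)) pw1.
have A0 := Re_herglotz_sum_ge0 (predC1 j) w1.
(* If [s j = i], both terms contain the singular part and agree with the real part of [G w] up to
   small remainders. Otherwise neither contains it, and both are bounded by those remainders. *)
rewrite ReN ltr_norml; have [ij|ij] := eqVneq (s j) i.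
  have -> : herglotz_sum (fun j => s j == i) w =
      herglotz_sum (pred1 j) w + herglotz_sum (fun k => (s k == i) && (k != j)) w.
    by rewrite herglotz_sum_pred1 /herglotz_sum (bigD1 j) //= ij.
  have := Re_herglotz_sum_ge0 (fun k => (s k == i) && (k != j)) w1.
  have : complex.Re (herglotz_sum (fun k => (s k == i) && (k != j)) w) <= complex.Re (herglotz_sum (predC1 j) w).
    by apply: Re_herglotz_sum_le => // k /andP[].
  by rewrite ReD -ij; lra.
have := Re_herglotz_sum_ge0 (pred1 i) pw1.
have := Re_herglotz_sum_ge0 (fun j => s j == i) w1.
have : complex.Re (herglotz_sum (pred1 i) (psi w)) <= complex.Re (herglotz_sum (predC1 (s j)) (psi w)).
  by apply: Re_herglotz_sum_le => // k /eqP ->; rewrite /= eq_sym.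
have : complex.Re (herglotz_sum (fun j => s j == i) w) <= complex.Re (herglotz_sum (predC1 j) w).
  by apply: Re_herglotz_sum_le => // k /eqP sk /=; apply: contraNneq ij => <-; rewrite sk.
lra.
Qed.

Lemma psi_permutes_poles : (0 < N)%N -> exists s : 'I_N -> 'I_N, [/\ injective s,
  (forall j, forall rho : R, 0 < rho -> exists2 d : R, 0 < d &
    forall z, md z < 1 -> md (z - pole j) < d -> md (psi z - pole (s j)) < rho) &
  forall j, exists2 tau : C, complex.Re tau = 0 & forall z, md z < 1 ->
    (lam (s j))%:C * herglotz (alpha (s j)) (psi z) =
    (lam j)%:C * herglotz (alpha j) z + tau].
Proof.
move=> N0; have [s hs] := choice psi_pole_limit; exists s.
have [E hE] := ex2_psi N0.
pose D i z : C := herglotz_sum (pred1 i) (psi z) - herglotz_sum (fun j => s j == i) z.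
have dD i z : md z < 1 -> derivable (D i) z 1.
  move=> z1; apply: (@derivableB C C C).
    by apply: derivable_herglotz_sum_comp; [exact: psi_derivable | exact: psi_disk].
  by apply: (@derivable_herglotz_sum_comp _ id) => //; exact: derivable_id.
have inD P z : md z < 1 -> ex2 (herglotz_sum P) z.
  move=> z1; have [|//] := @ex2_herglotz_sum P z.
  by move=> j _; apply: contraTneq z1 => ->; rewrite md_pole ltxx.
have D2 i z : md z < 1 -> z \notin E -> ex2 (D i) z.
  move=> z1 zE; have h1 := ex2_comp (inD (pred1 i) _ (psi_disk z1)) (hE _ z1 zE).
  have := ex2D h1 (ex2Z (-1) (inD (fun j => s j == i) _ z1)).
  by congr ex2; apply/funext => x; rewrite mulN1r.
have D0 i z : md z < 1 -> complex.Re (D i z) = 0.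
  by apply: (max_principle_eq0 (dD i) (D2 i)); exact: fiber_herglotz_small.
have z01 : md (0 : C) < 1 by rewrite md0.
(* An empty fibre would make the positive number [lam i * Re (H_i (psi 0))] vanish. *)
have surj i : exists j, s j = i.
  have [/existsP[j /eqP] | no] := boolP [exists j, s j == i]; first by exists j.
  have := D0 i _ z01; rewrite /D /herglotz_sum big_pred1_eq [X in _ - X]big_pred0 => [|j].
    rewrite subr0 ReZ => /eqP; rewrite mulf_eq0 !gt_eqF //.
    by rewrite Re_herglotz_gt0 // psi_disk.
  by apply: contraNF no => sj; apply/existsP; exists j.
(* A section [g] of [s] is injective, hence bijective on the finite type, and [s] is its inverse.
   Each fibre is then a single index. *)
have [g gs] := choice surj.
have gi : injective g by move=> k l /(congr1 s); rewrite !gs.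
have [g' g1 g2] := injF_bij gi.
have sE k : s k = g' k by rewrite -{1}[k]g2 gs.
have si : injective s by move=> k l; rewrite !sE => /(can_inj g2).
split=> // j; exists (D (s j) 0); first exact: D0.
move=> z z1; rewrite -(Re_eq0_const (dD (s j)) (D0 (s j)) z1) /D.
rewrite herglotz_sum_pred1 (_ : herglotz_sum (fun _ => _) z = herglotz_sum (pred1 j) z).
  by rewrite herglotz_sum_pred1 addrC subrK.
by apply: eq_bigl => k; rewrite (inj_eq si).
Qed.
End BoundaryBehaviour.

(** * Moebius maps of the disk *)

Section Moebius.
Context {R : realType}.
Local Notation C := (Cx R).
Implicit Types (a b kappa q x y z w t : C).

Lemma conj_neq0 z : z != 0 -> conjc z != 0 :> C.
Proof. by rewrite -!md_eq0 mdJ. Qed.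

Lemma conjE : ((forall z w, (conjc (z + w) = conjc z + conjc w :> C)%R) *
  (forall z, (conjc (- z) = - conjc z :> C)%R) *
  (forall z w, (conjc (z * w) = conjc z * conjc w :> C)%R) *
  (forall z, (conjc z^-1 = (conjc z)^-1 :> C)%R) *
  (conjc 1%R = 1%R :> C) * (forall r : R, conjc r%:C = r%:C :> C) *
  (forall z, conjc (conjc z) = z :> C))%type.
Proof.
refine (pair (pair (pair (pair (pair (pair _ _) _) _) _) _) _) => *;
by rewrite ?(rmorphD, rmorphN, rmorphM, fmorphV, conjc1, conjcK, conjc_real).
Qed.

Lemma mob_den_neq0 b z : md b < 1 -> md z <= 1 -> 1 - conjc b * z != 0.
Proof.
move=> b1 z1; rewrite -md_gt0P.
have := mdD (1 - conjc b * z) (conjc b * z); rewrite subrK md1 mdM mdJ.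
have : md b * md z <= md b by rewrite ler_piMr ?md_ge0.
lra.
Qed.

Lemma md_mob b z : md b < 1 -> md z <= 1 ->
  1 - md (mob b z) ^+ 2 = (1 - md b ^+ 2) * (1 - md z ^+ 2) / md (1 - conjc b * z) ^+ 2.
Proof.
move=> b1 z1; have D0 := mob_den_neq0 b1 z1.
have mD : md (1 - conjc b * z) ^+ 2 != 0 by rewrite expf_neq0 // md_eq0.
apply: (canRL (mulfK mD)); rewrite mulrBl mul1r -exprMn -mdM /mob divfK //.
by rewrite !md_sq; case: (b) (z) => [? ?] [? ?] /=; ring.
Qed.

Lemma md_mob_lt1 b z : md b < 1 -> md z < 1 -> md (mob b z) < 1.
Proof.
move=> b1 z1; rewrite -[ltRHS](expr1n _ 2) -(@ltr_pXn2r R 2) ?nnegrE ?md_ge0 //.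
rewrite !expr1n -subr_gt0 (md_mob b1 (ltW z1)) divr_gt0 //.
  by rewrite mulr_gt0 // subr_gt0 exprn_ilt1 ?md_ge0.
by rewrite exprn_gt0 // md_gt0P mob_den_neq0 // ltW.
Qed.

Lemma mobNK b z : md b < 1 -> md z <= 1 -> mob (- b) (mob b z) = z.
Proof.
move=> b1 z1; have D0 := mob_den_neq0 b1 z1.
have B0 : 1 - conjc b * b != 0 by rewrite mob_den_neq0 ?ltW.
rewrite /mob !conjE; field.
rewrite D0 /=; rewrite (_ : _ + _ = 1 - conjc b * b) //; ring.
Qed.

Lemma mobKN b z : md b < 1 -> md z <= 1 -> mob b (mob (- b) z) = z.
Proof. by move=> b1; rewrite -{1}[b]opprK; apply: mobNK; rewrite mdN. Qed.

Lemma derivable_mob b z : md b < 1 -> md z <= 1 -> derivable (mob b) z 1.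
Proof.
move=> b1 z1; apply: (@derivable_div R (fun x => x - b) (fun x => 1 - conjc b * x)).
- apply: (@derivableB C C C); [exact: derivable_id | exact: derivable_cst].
- exact: derivable_1B.
- by rewrite mob_den_neq0.
Qed.

(** Clearing denominators gives [a' * w * (conjc A + conjc B * (a * z)) = A * (a * z) + B]; the
    conjugates appear because [tau] is imaginary. The squared moduli of [A] and [B] differ by
    [4 * p * p' > 0], which places [b] inside the disk. *)
Lemma herglotz_eq_mob a a' (p p' : R) (tau : C) : md a = 1 -> md a' = 1 ->
  0 < p -> 0 < p' -> complex.Re tau = 0 ->
  exists kappa b, [/\ md kappa = 1, md b < 1 &
    forall z w, md z < 1 -> md w < 1 ->
      p'%:C * herglotz a' w = p%:C * herglotz a z + tau -> w = kappa * mob b z].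
Proof.
move=> a1 a'1 p0 p'0 tau0.
pose A : C := (p + p')%:C - tau; pose B : C := (p - p')%:C + tau.
have tJ : conjc tau = - tau.
  by move: tau0; case: (tau) => u v /= ->; rewrite -[RHS]/(_ +i* _) oppr0.
have AJ : conjc A = (p + p')%:C + tau by rewrite /A !conjE tJ opprK.
have BJ : conjc B = (p - p')%:C - tau by rewrite /B !conjE tJ.
have BA : md B < md A.
  rewrite -(@ltr_pXn2r R 2) ?nnegrE ?md_ge0 // !md_sq /A /B.
  move: tau0; case: (tau) => u v /= ->; have := mulr_gt0 p0 p'0; lra.
have A0 : A != 0 by rewrite -md_gt0P; apply: le_lt_trans BA; exact: md_ge0.
have a0 : a != 0 by rewrite -md_eq0 a1 oner_eq0.
have a'0 : a' != 0 by rewrite -md_eq0 a'1 oner_eq0.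
have AJ0 := conj_neq0 A0.
have mA : 0 < md A by rewrite md_gt0P.
pose b : C := - (conjc a * B / A).
have bJ : conjc b = - (a * conjc B / conjc A).
  by rewrite /b !conjE.
have b1 : md b < 1.
  by rewrite /b mdN !mdM mdJ a1 mul1r mdV ltr_pdivrMr // mul1r.
exists (a / a' * (A / conjc A)), b; split=> // [|z w z1 w1 e].
  by rewrite !(mdM, mdV) a1 a'1 mdJ divr1 mul1r divff ?gt_eqF.
have n1 := sub1_neq0 a1 z1; have n2 := sub1_neq0 a'1 w1.
have D0 := mob_den_neq0 b1 (ltW z1).
have D1 : conjc A + conjc B * (a * z) != 0.
  have -> : conjc A + conjc B * (a * z) = conjc A * (1 - conjc b * z) by rewrite bJ; field.
  by rewrite mulf_neq0.
have e1 : (p'%:C * (1 + a' * w)) * (1 - a * z) = (p%:C * (1 + a * z) + tau * (1 - a * z)) * (1 - a' * w).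
  move: e; rewrite /herglotz => e.
  transitivity (p'%:C * ((1 + a' * w) / (1 - a' * w)) * ((1 - a * z) * (1 - a' * w))).
    by field.
  by rewrite e; field.
have e2 : a' * w * (conjc A + conjc B * (a * z)) = A * (a * z) + B.
  apply/eqP; rewrite -subr_eq0; apply/eqP.
  transitivity ((p'%:C * (1 + a' * w)) * (1 - a * z) - (p%:C * (1 + a * z) + tau * (1 - a * z)) * (1 - a' * w)).
    by rewrite AJ BJ /A /B !rmorphD rmorphN /=; ring.
  by rewrite e1 subrr.
apply: (mulfI a'0); apply: (mulIf D1); rewrite e2 /mob.
rewrite bJ /b (conjcV_unit a1).
move: D1; move: (conjc A) (conjc B) AJ0 => A' B' A'0 D1; field.
by rewrite a'0 a0 A'0 A0 (_ : A' - - (a * B') * z = A' + B' * (a * z)) ?D1 //; ring.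
Qed.

(** The fixed-point equation makes the numerator of [mob a (kappa * mob b z)] a multiple of [z - a],
    and its conjugate makes the denominator a multiple of [1 - conjc a * z]; [xi] is the quotient of
    the two factors. *)
Lemma rotated_mob_fixed_interior kappa b a : md kappa = 1 -> md b < 1 -> md a < 1 ->
  kappa * mob b a = a ->
  exists xi : C, forall z, md z <= 1 -> mob a (kappa * mob b z) = xi * mob a z.
Proof.
move=> k1 b1 a1 fa; have k0 : kappa != 0 by rewrite -md_eq0 k1 oner_eq0.
have D0 := mob_den_neq0 b1 (ltW a1).
have fa1 : kappa * (a - b) = a * (1 - conjc b * a).
  transitivity (kappa * mob b a * (1 - conjc b * a)); last by rewrite fa.
  by rewrite /mob; field.
have fa2 : conjc b + conjc a * kappa = conjc a * (1 + conjc a * kappa * b).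
  have := congr1 (fun x => kappa * conjc x) fa1.
  rewrite !conjE (conjcV_unit k1).
  rewrite mulrA mulfV // mul1r => e.
  apply/eqP; rewrite -subr_eq0; apply/eqP.
  transitivity (kappa * (conjc a * (1 - b * conjc a)) - (conjc a - conjc b)); first by ring.
  by rewrite -e subrr.
exists ((kappa + a * conjc b) / (1 + conjc a * kappa * b)) => z z1.
have Dz := mob_den_neq0 b1 z1; have Da := mob_den_neq0 a1 z1.
have E0 : 1 + conjc a * kappa * b != 0.
  rewrite -md_gt0P; have := mdD (1 + conjc a * kappa * b) (- (conjc a * kappa * b)).
  rewrite addrK md1 mdN !mdM mdJ k1 mulr1.
  have : md a * md b <= md b by rewrite ler_piMl ?md_ge0 ?ltW.
  lra.
have num : kappa * (z - b) - a * (1 - conjc b * z) = (kappa + a * conjc b) * (z - a).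
  apply/eqP; rewrite -subr_eq0; apply/eqP.
  transitivity (kappa * (a - b) - a * (1 - conjc b * a)); first by ring.
  by rewrite fa1 subrr.
have den : (1 - conjc b * z) - conjc a * (kappa * (z - b)) = (1 + conjc a * kappa * b) * (1 - conjc a * z).
  apply/eqP; rewrite -subr_eq0; apply/eqP.
  transitivity (z * (conjc a * (1 + conjc a * kappa * b) - (conjc b + conjc a * kappa))); first by ring.
  by rewrite fa2 subrr mulr0.
have N0 : (1 - conjc b * z) - conjc a * (kappa * (z - b)) != 0 by rewrite den mulf_neq0.
rewrite /mob.
transitivity ((kappa * (z - b) - a * (1 - conjc b * z)) / ((1 - conjc b * z) - conjc a * (kappa * (z - b)))).
  by field; apply/andP; split; [exact: N0 | exact: Dz].
by rewrite num den; field; apply/andP; split; [exact: Da | exact: E0].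
Qed.

(** For [b != 0] fixed points are roots of a quadratic [Q] whose root set is stable under reflection
    in the circle. A root outside the closed disk is therefore replaced by its reflection. *)
Lemma rotated_mob_fixed_point kappa b : md kappa = 1 -> md b < 1 ->
  exists2 a, md a <= 1 & kappa * mob b a = a.
Proof.
move=> k1 b1; have [->|b0] := eqVneq b 0.
  by exists 0; rewrite ?md0 ?ler01 // /mob subrr mul0r mulr0.
have k0 : kappa != 0 by rewrite -md_eq0 k1 oner_eq0.
have bJ0 := conj_neq0 b0.
pose Q z := conjc b * z ^+ 2 + (kappa - 1) * z - kappa * b.
have fixQ z : md z <= 1 -> Q z = 0 -> kappa * mob b z = z.
  move=> z1 qz; have D0 := mob_den_neq0 b1 z1.
  apply: (mulIf D0); rewrite /mob mulrA divfK //; apply/eqP; rewrite -subr_eq0; apply/eqP.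
  by rewrite -qz /Q; ring.
pose p : C := sqrtc ((kappa - 1) ^+ 2 + 4 * (conjc b * (kappa * b))).
have pE : p ^+ 2 = (kappa - 1) ^+ 2 + 4 * (conjc b * (kappa * b)) by exact: sqr_sqrtc.
pose z : C := (p - (kappa - 1)) / (2 * conjc b).
have qz : Q z = 0.
  transitivity ((p ^+ 2 - ((kappa - 1) ^+ 2 + 4 * (conjc b * (kappa * b)))) / (4 * conjc b)).
    by rewrite /Q /z; move: (conjc b) bJ0 => b' b'0; field.
  by rewrite pE subrr mul0r.
move: z qz => {p pE} z qz.
have [z1|z1] := leP (md z) 1; first by exists z => //; exact: fixQ.
have z0 : z != 0 by rewrite -md_gt0P; apply: lt_trans z1.
have w1 : md ((conjc z)^-1) <= 1 by rewrite mdV mdJ invf_le1 ?ltW //; apply: lt_trans z1.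
exists (conjc z)^-1 => //; apply: fixQ => //.
transitivity (- kappa / conjc z ^+ 2 * conjc (Q z)); last by rewrite qz conjc0 mulr0.
have zJ0 := conj_neq0 z0.
rewrite /Q !(expr2, conjE) (conjcV_unit k1).
move: (conjc b) (conjc z) zJ0 => b' z' z'0; field.
by rewrite z'0 k0.
Qed.

(** For [q] on the circle this maps the disk onto the half-plane [Re > 1 / 2] and sends [q] to
    infinity. At [q] itself the inverse has the default value 0, whence the conditions [z != q]
    below. *)
Definition cayley q z : C := (1 - conjc q * z)^-1.

Lemma md1_sub_neq0 q z : md q = 1 -> z != q -> 1 - conjc q * z != 0.
Proof.
move=> q1 zq; have q0 : q != 0 by rewrite -md_eq0 q1 oner_eq0.
apply: contra zq; rewrite conjcV_unit // subr_eq0 => /eqP e.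
by apply/eqP; rewrite -[z](mulVKf q0) -e mulr1.
Qed.

Lemma cayley_inj q z w : md q = 1 -> z != q -> w != q -> cayley q z = cayley q w -> z = w.
Proof.
move=> q1 zq wq /invr_inj /addrI /oppr_inj /mulfI; apply.
by apply: conj_neq0; rewrite -md_eq0 q1 oner_eq0.
Qed.

(** Fixing [q] means fixing infinity in the half-plane coordinate, so the map becomes affine. Its
    slope [(1 - conjc b * q) / E] is real and positive because [E * (1 - b / q) = 1 - md b ^+ 2]. *)
Lemma rotated_mob_fixed_boundary kappa b q : md kappa = 1 -> md b < 1 -> md q = 1 ->
  kappa * mob b q = q ->
  exists2 c : R, 0 < c & exists d : C, forall z, md z <= 1 -> z != q ->
    kappa * mob b z != q /\ cayley q (kappa * mob b z) = c%:C * cayley q z + d.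
Proof.
move=> k1 b1 q1 fq; have k0 : kappa != 0 by rewrite -md_eq0 k1 oner_eq0.
have q0 : q != 0 by rewrite -md_eq0 q1 oner_eq0.
have q1' : md q <= 1 by rewrite q1.
have Dq := mob_den_neq0 b1 q1'.
have fq1 : kappa * (q - b) = q * (1 - conjc b * q).
  transitivity (kappa * mob b q * (1 - conjc b * q)); last by rewrite fq.
  by rewrite /mob; field.
pose E := 1 + q^-1 * kappa * b.
have b2 : 0 < 1 - md b ^+ 2 by rewrite subr_gt0 exprn_ilt1 ?md_ge0.
have EE : E * (1 - b * q^-1) = (1 - md b ^+ 2)%:C.
  rewrite rmorphB /= -mulJ; apply/eqP; rewrite -subr_eq0; apply/eqP.
  transitivity (b / q ^+ 2 * (kappa * (q - b) - q * (1 - conjc b * q))).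
    by rewrite /E rmorph1; field.
  by rewrite fq1 subrr mulr0.
have b20 : (1 - md b ^+ 2)%:C != 0 :> C by rewrite -md_eq0 mdR normr_eq0 gt_eqF.
have E0 : E != 0 by move: b20; rewrite -EE mulf_eq0 negb_or => /andP[].
have bq0 : 1 - b * q^-1 != 0 by move: b20; rewrite -EE mulf_eq0 negb_or => /andP[].
have qb0 : q - b != 0.
  by apply: contra bq0; rewrite !subr_eq0 => /eqP <-; rewrite divff.
have ratio : (1 - conjc b * q) / E = (md (1 - conjc b * q) ^+ 2 / (1 - md b ^+ 2))%:C.
  rewrite rmorphM fmorphV /= -EE -mulJ !conjE (conjcV_unit q1).
  by field; rewrite q0 qb0 E0.
exists (md (1 - conjc b * q) ^+ 2 / (1 - md b ^+ 2)).
  by rewrite divr_gt0 // exprn_gt0 // md_gt0P.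
exists (conjc b * q / E) => z z1 zq.
have Dz := mob_den_neq0 b1 z1; have Kz := md1_sub_neq0 q1 zq.
have key : 1 - conjc q * (kappa * mob b z) = E * (1 - conjc q * z) / (1 - conjc b * z).
  apply: (mulIf Dz); rewrite divfK // (conjcV_unit q1).
  transitivity ((1 - conjc b * z) - q^-1 * (kappa * (z - b))).
    by rewrite /mob; field; apply/andP; split; [exact: q0 | exact: Dz].
  apply/eqP; rewrite -subr_eq0; apply/eqP.
  transitivity (z * (q^-1 ^+ 2 * (kappa * (q - b) - q * (1 - conjc b * q)) * (- 1) + 0)).
    rewrite /E; field; exact: q0.
  by rewrite fq1 subrr mulr0 mul0r addr0 mulr0.
split.
  apply: contraTneq E0 => e; move: key; rewrite e [conjc q * q]mulrC mulJ q1 expr1n subrr.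
  move/esym/eqP; rewrite !mulf_eq0 invr_eq0 (negbTE Dz) (negbTE Kz) !orbF.
  by move=> ->.
rewrite -ratio /cayley key invf_div.
move: Kz; rewrite (conjcV_unit q1) => Kz.
by field; rewrite E0 q0 subr_eq0 eq_sym zq.
Qed.

Lemma affine_fixed2 x y w t : x = w * x + t -> y = w * y + t -> x - y != 0 -> w = 1.
Proof.
move=> hx hy xy; apply: (mulIf xy); rewrite mul1r mulrBr.
by rewrite [in RHS]hx [in RHS]hy opprD addrACA subrr addr0.
Qed.

(** In the coordinate [cayley q] the map is [x -> c * x + d]. Its iterate of order [m], the order of
    the permutation, fixes two distinct finite points, so [c ^+ m = 1]; positivity gives [c = 1],
    and then [m * d = 0]. *)
Lemma fixed_boundary_permutes_id (N : nat) (p : 'I_N -> C) (s : 'I_N -> 'I_N)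
    kappa b q (j k : 'I_N) :
  md kappa = 1 -> md b < 1 -> md q = 1 -> kappa * mob b q = q ->
  (forall i, md (p i) = 1) -> injective p -> injective s ->
  (forall i, kappa * mob b (p i) = p (s i)) ->
  j != k -> p j != q -> p k != q ->
  forall z, md z < 1 -> kappa * mob b z = z.
Proof.
move=> k1 b1 q1 fq p1 pi si ps jk pj pk.
have [c c0 [d hc]] := rotated_mob_fixed_boundary k1 b1 q1 fq.
have step i m : p i != q -> p (iter m s i) != q /\
    cayley q (p (iter m s i)) = (c ^+ m)%:C * cayley q (p i) + \sum_(l < m) (c ^+ l)%:C * d.
  move=> pq; elim: m => [|m [IH1 IH2]]; first by rewrite big_ord0 addr0 mul1r.
  have [h1 h2] := hc (p (iter m s i)) ltac:(by rewrite p1) IH1.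
  rewrite iterS -ps; split => //; rewrite h2 IH2 big_ord_recl mul1r mulrDr mulrA -rmorphM -exprS.
  rewrite -!addrA; congr (_ + _); rewrite addrC; congr (_ + _); rewrite mulr_sumr.
  by apply: eq_bigr => l _; rewrite mulrA -rmorphM -exprS.
pose m := #[perm si]%g.
have iter_m i : iter m s i = i.
  have <- : (perm si ^+ m)%g i = iter m s i.
    by rewrite permX; apply: eq_iter => x; rewrite permE.
  by rewrite expg_order perm1.
have [_ hj] := step j m pj; have [_ hk] := step k m pk.
rewrite !iter_m in hj hk.
have cm : (c ^+ m)%:C = 1 :> C.
  have n0 : cayley q (p j) - cayley q (p k) != 0.
    by rewrite subr_eq0; apply: contra jk => /eqP /(cayley_inj q1 pj pk) /pi ->.
  by apply: (affine_fixed2 hj hk).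
have c1 : c = 1.
  have : c ^+ m = 1 by apply: (@complexI R).
  by move/eqP; rewrite pexpr_eq1 ?ltW ?order_gt0 // => /eqP.
have d0 : d = 0.
  move: hj; rewrite cm mul1r => /eqP; rewrite -subr_eq0 opprD addrA subrr sub0r oppr_eq0.
  under eq_bigr => l _ do rewrite c1 expr1n mul1r.
  rewrite sumr_const card_ord -mulr_natl mulf_eq0 pnatr_eq0.
  by rewrite (gtn_eqF (order_gt0 _)) => /eqP.
move=> z z1; have zq : z != q by apply: contraTneq z1 => ->; rewrite q1 ltxx.
have [h1 h2] := hc z (ltW z1) zq.
by apply: (cayley_inj q1 h1 zq); rewrite h2 c1 d0 mul1r addr0.
Qed.
End Moebius.

(** * A competitor excluding constant extremal functions *)

Section Extremal.
Context {R : realType}.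
Local Notation C := (Cx R).

Lemma nbhs_disk (z : C) : md z < 1 -> \forall w \near z, md w < 1.
Proof.
move=> z1; apply/nbhs_ballP; exists ((1 - md z)%:C : C) => /=.
  by rewrite ltcR subr_gt0.
move=> w; rewrite -ball_normE /= mdE ltcR => zw.
have := mdD (w - z) z; rewrite subrK mdBC; lra.
Qed.

Lemma Mn_eq_cst n (f : C -> C) (c : C) : (0 < n)%N ->
  (forall z, md z < 1 -> f z = c) -> Mn n f = 0.
Proof.
case: n => // n _ fc.
have d0 m z : md z < 1 -> derive1n m f z = if m is 0%N then c else 0.
  elim: m z => [|m IH] z z1; first exact: fc.
  rewrite derive1nS derive1E.
  rewrite (@near_eq_derive _ _ _ _ (fun=> if m is 0%N then c else 0)).
    by rewrite -derive1E derive1_cst.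
  by apply: filterS (nbhs_disk z1) => w; exact: IH.
by rewrite /Mn /taylor_coef d0 ?md0 // mul0r.
Qed.

Lemma is_derive_hornerC (p : {poly C}) (x : C) : is_derive x 1 (horner p) p^`().[x].
Proof.
elim/poly_ind: p => [|p c ih].
  rewrite (_ : horner 0 = cst 0); last by apply/funext => y; rewrite horner0.
  by rewrite deriv0 horner0; exact: is_derive_cst.
have -> : horner (p * 'X + c%:P) = (horner p * id) + cst c.
  by apply/funext => y; rewrite !hornerE.
have := @is_deriveD C C C _ _ x 1 _ _
  (@is_deriveM C C _ _ x 1 _ _ ih (is_derive_id x 1)) (is_derive_cst c x 1).
move=> /is_derive_eq; apply.
by rewrite derivD derivM derivC derivX !hornerE /GRing.scale /= addrC mulr1 [x * _]mulrC.
Qed.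

Lemma derive1_hornerC (p : {poly C}) : derive1 (horner p) = horner p^`().
Proof.
by apply/funext => x; rewrite derive1E; have [_ ->] := is_derive_hornerC p x.
Qed.

(** For [n > 0] the polynomial [(2 + z ^+ n) / 3] has modulus between [1 / 3] and 1 on the disk and
    a positive coefficient of order [n], so it beats every constant. *)
Definition competitor n : {poly Cx R} := (3^-1)%:C%:P * (2%:R%:P + 'X^n).

Lemma competitorE n z : (competitor n).[z] = (3^-1)%:C * (2 + z ^+ n).
Proof. by rewrite /competitor !hornerE. Qed.

Lemma competitor_B0 n : B0 (horner (competitor n)).
Proof.
split=> [z _|z]; first by have [] := is_derive_hornerC (competitor n) z.
rewrite disk_md competitorE => z1; rewrite !mdE -[0]/(0%:C) -[X in _ <= X]/(1%:C) ltcR lecR.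
have zn : md (z ^+ n) <= 1 by rewrite mdX exprn_ile1 ?md_ge0 // ltW.
have two : md (2 : C) = 2 by rewrite -[2 in LHS](rmorph_nat (real_complex R)) mdR normr_nat.
rewrite mdM mdR ger0_norm ?invr_ge0 //.
have := mdD 2 (z ^+ n); have := mdD (2 + z ^+ n) (- z ^+ n).
rewrite addrK mdN two; lra.
Qed.

Lemma Mn_competitor n : (0 < n)%N -> Mn n (horner (competitor n)) = 3^-1.
Proof.
move=> n0; have dE m : derive1n m (horner (competitor n)) = horner (competitor n)^`(m).
  by elim: m => // m IH; rewrite derive1nS IH derive1_hornerC derivnS.
rewrite /Mn /taylor_coef dE horner_coef0 coef_derivn addn0 ffactnn.
rewrite /competitor coefCM coefD coefC coefXn eqxx (gtn_eqF n0) add0r mulr1.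
rewrite -[_ *+ _]mulr_natr mulfK //; have := fact_gt0 n; by rewrite pnatr_eq0 lt0n.
Qed.

(** This excludes [N = 0], where the exponential representation is constant. *)
Lemma extremal_not_cst n (f : C -> C) (c : C) : (0 < n)%N -> extremal n f ->
  ~ (forall z, md z < 1 -> f z = c).
Proof.
move=> n0 [_ [_ hf]] fc; have := hf _ (competitor_B0 n).
by rewrite Mn_competitor // (Mn_eq_cst n0 fc) leNgt invr_gt0 ltr0n.
Qed.

Lemma md_cexp (z : C) : md (cexp z) = expR (complex.Re z).
Proof.
have e0 := expR_gt0 (complex.Re z).
apply/eqP; rewrite -(@eqrXn2 _ 2) ?md_ge0 ?ltW // md_sq /cexp /=.
by rewrite !exprMn -mulrDr cos2Dsin2 mulr1.
Qed.
End Extremal.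

(** * Fixed points of a Moebius map permuting the poles *)

Section Assembly.
Context {R : realType}.
Local Notation C := (Cx R).
Implicit Types (a b kappa q x y z w t : C).

Variables (N : nat) (p : 'I_N -> C) (s : 'I_N -> 'I_N) (psi : C -> C) (kappa b : C).
Hypotheses (k1 : md kappa = 1) (b1 : md b < 1).
Hypotheses (p1 : forall j, md (p j) = 1) (p_inj : injective p) (s_inj : injective s).
Hypothesis psiE : forall z, md z < 1 -> psi z = kappa * mob b z.
Hypothesis psi_p : forall j, kappa * mob b (p j) = p (s j).

Lemma md_rotated_mob_lt1 z : md z < 1 -> md (kappa * mob b z) < 1.
Proof. by move=> z1; rewrite mdM k1 mul1r md_mob_lt1. Qed.

Lemma rotated_mob_is_aut : holD psi -> is_aut psi.
Proof.
have k0 : kappa != 0 by rewrite -md_eq0 k1 oner_eq0.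
have kV : md kappa^-1 = 1 by rewrite mdV k1 invr1.
have bN : md (- b) < 1 by rewrite mdN.
have kz z : md z < 1 -> md (kappa^-1 * z) < 1 by rewrite mdM kV mul1r.
move=> hpsi; split=> //; split=> [z|].
  by rewrite !disk_md => z1; rewrite psiE // md_rotated_mob_lt1.
exists (fun z => mob (- b) (kappa^-1 * z)); split=> z; rewrite ?disk_md => z1.
- apply: (@derivable_div R (fun x => kappa^-1 * x - (- b)) (fun x => 1 - conjc (- b) * (kappa^-1 * x))).
  + apply: (@derivableB C C C); last exact: derivable_cst.
    apply: (@derivableM C C (fun=> _) _ z 1); [exact: derivable_cst | exact: derivable_id].
  + apply: (@derivableB C C C); first exact: derivable_cst.
    apply: (@derivableM C C (fun=> _) _ z 1); first exact: derivable_cst.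
    apply: (@derivableM C C (fun=> _) _ z 1); [exact: derivable_cst | exact: derivable_id].
  + by apply: mob_den_neq0 => //; rewrite ltW // kz.
- by rewrite md_mob_lt1 // kz.
- by rewrite psiE // mulrA mulVf // mul1r mobNK // ltW.
- rewrite psiE; first by rewrite mobKN ?ltW ?kz // mulrA mulfV // mul1r.
  by rewrite md_mob_lt1 // kz.
Qed.

Definition elliptic_conclusion := exists a : C, exists xi : C,
  [/\ disk a, xi ^+ N = 1,
      (forall z, disk z -> psi z = mob (- a) (xi * mob a z)),
      psi a = a & (forall z, disk z -> iter N psi z = z)].

Lemma fixed_interior_elliptic a : md a < 1 -> kappa * mob b a = a -> elliptic_conclusion.
Proof.
move=> a1 fa; have [xi hxi] := rotated_mob_fixed_interior k1 b1 a1 fa.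
have psi1 z : md z < 1 -> md (psi z) < 1 by move=> z1; rewrite psiE // md_rotated_mob_lt1.
have psi_xi z : md z < 1 -> mob a (psi z) = xi * mob a z.
  by move=> z1; rewrite psiE // hxi // ltW.
(* Reindexing the nonzero product of the [mob a (p j)] by [s] multiplies each of the [N] factors by
   [xi]. *)
have xiN : xi ^+ N = 1.
  have P0 : \prod_j mob a (p j) != 0.
    apply/prodf_neq0 => j _; rewrite mulf_neq0 ?invr_neq0 //.
      by rewrite subr_eq0; apply: contraTneq a1 => <-; rewrite p1 ltxx.
    by rewrite mob_den_neq0 // p1.
  apply: (mulIf P0); rewrite mul1r [RHS](reindex_inj s_inj) /=.
  have -> : xi ^+ N = \prod_(j < N) xi by rewrite prodr_const card_ord.
  rewrite -big_split /=.
  by apply: eq_bigr => j _; rewrite -psi_p hxi // p1.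
exists a, xi; split=> //; rewrite ?disk_md //.
- by move=> z; rewrite disk_md => z1; rewrite -psi_xi // mobNK // ltW // psi1.
- by rewrite psiE.
- move=> z; rewrite disk_md => z1.
  have it m : md (iter m psi z) < 1 /\ mob a (iter m psi z) = xi ^+ m * mob a z.
    elim: m => [|m [h1 h2]]; first by rewrite mul1r.
    by rewrite iterS psi1 // psi_xi // h2 mulrA -exprS.
  have [h1 h2] := it N.
  by rewrite -[LHS](mobNK a1 (ltW h1)) h2 xiN mul1r mobNK // ltW.
Qed.

(** If [q] lies on the circle, the map is the identity on the disk, so 0 is an interior fixed
    point. *)
Lemma two_poles_fixed_interior q j k : md q <= 1 -> kappa * mob b q = q ->
  j != k -> p j != q -> p k != q -> exists2 a, md a < 1 & kappa * mob b a = a.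
Proof.
rewrite le_eqVlt => /orP[/eqP q1|q1] fq jk pj pk; last by exists q.
exists 0; rewrite ?md0 ?ltr01 //.
apply: (fixed_boundary_permutes_id k1 b1 q1 fq p1 p_inj s_inj psi_p jk pj pk).
by rewrite md0.
Qed.

(** Of three distinct poles at least two differ from a given fixed point. *)
Lemma elliptic_of_ge3 : (3 <= N)%N -> elliptic_conclusion.
Proof.
move=> N3; have [q q1 fq] := rotated_mob_fixed_point k1 b1.
pose i0 := Ordinal (leq_trans (isT : (0 < 3)%N) N3).
pose i1 := Ordinal (leq_trans (isT : (1 < 3)%N) N3).
pose i2 := Ordinal (leq_trans (isT : (2 < 3)%N) N3).
have [j [k [jk pj pk]]] : exists j k, [/\ j != k, p j != q & p k != q].
  have [e0|n0] := eqVneq (p i0) q.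
    by exists i1, i2; rewrite -e0 !(inj_eq p_inj).
  have [e1|n1] := eqVneq (p i1) q.
    by exists i0, i2; rewrite -e1 !(inj_eq p_inj).
  by exists i0, i1.
have [a a1 fa] := two_poles_fixed_interior q1 fq jk pj pk.
exact: fixed_interior_elliptic fa.
Qed.

(** Without an interior fixed point, [two_poles_fixed_interior] forces every fixed point in the
    closed disk to be a pole. The Moebius formula serves as the continuous extension [Psi]. *)
Lemma elliptic_or_hyperbolic : N = 2%N -> elliptic_conclusion \/
  exists Psi : C -> C,
       [/\ {within @cdisk R, continuous Psi},
           (forall z, disk z -> Psi z = psi z),
           (forall j, Psi (p j) = p j) &
           (forall z, cdisk z -> Psi z = z -> exists j, z = p j)].
Proof.
move=> N2; have [[a a1 fa]|no] := pselect (exists2 a, md a < 1 & kappa * mob b a = a).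
  by left; exact: fixed_interior_elliptic fa.
have [q q1 fq] := rotated_mob_fixed_point k1 b1.
pose i0 := Ordinal (leq_trans (isT : (0 < 2)%N) (eq_leq (esym N2))).
pose i1 := Ordinal (leq_trans (isT : (1 < 2)%N) (eq_leq (esym N2))).
have fixp z : md z <= 1 -> kappa * mob b z = z -> exists j, z = p j.
  move=> z1 fz; have [e0|n0] := eqVneq (p i0) z; first by exists i0.
  have [e1|n1] := eqVneq (p i1) z; first by exists i1.
  have i01 : i0 != i1 by [].
  by case: no; exact: (two_poles_fixed_interior z1 fz i01 n0 n1).
have i01P j : (j == i0) || (j == i1).
  by case: j => j jN; rewrite -!val_eqE /=; move: jN; rewrite {1}N2; case: j => [|[]].
(* A fixed point exists and is a pole, so [s] fixes one of the two indices and, being injective, the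
   other as well. *)
have s_id j : s j = j.
  have [j0 qj] := fixp _ q1 fq.
  have sj0 : s j0 = j0 by apply: p_inj; rewrite -psi_p -qj.
  have [->//|jj0] := eqVneq j j0.
  have sjj0 : s j != j0 by rewrite -sj0 (inj_eq s_inj).
  case/orP: (i01P j0) => /eqP e0; case/orP: (i01P j) => /eqP e1; case/orP: (i01P (s j)) => /eqP e2;
  by move: sjj0 jj0; rewrite e2 e0 e1 ?eqxx.
right; exists (fun z => kappa * mob b z); split.
- apply/subspace_continuousP => z; rewrite cdisk_md => z1.
  apply: cvg_within_filter.
  have : derivable (fun z => kappa * mob b z : C) z 1.
    apply: (@derivableM C C (fun=> _) _ z 1); [exact: derivable_cst | exact: derivable_mob].
  by move=> /derivable1_diffP /differentiable_continuous.
- by move=> z; rewrite disk_md => z1; rewrite psiE.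
- by move=> j; rewrite psi_p s_id.
- by move=> z; rewrite cdisk_md; exact: fixp.
Qed.
End Assembly.

Unset Implicit Arguments.

Theorem theorem3 (R : realType) (n : nat) (f : Cx R -> Cx R)
    (N : nat) (lam : 'I_N -> R) (alpha : 'I_N -> Cx R) (psi : Cx R -> Cx R) :
  (3 <= n)%N ->
  extremal n f ->
  (N <= n)%N ->
  (forall j, 0 < lam j) ->
  (forall j, `|alpha j| = 1) ->
  injective alpha ->
  (forall z, disk z ->
     f z = cexp (- \sum_(j < N) (lam j)%:C * ((1 + alpha j * z) / (1 - alpha j * z)))) ->
  holD psi ->
  (forall z, disk z -> disk (psi z)) ->
  (forall z, disk z -> f (psi z) = f z) ->
  is_aut psi /\
  ((3 <= N)%N ->
     exists a : Cx R, exists xi : Cx R,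
       [/\ disk a, xi ^+ N = 1,
           (forall z, disk z -> psi z = mob (- a) (xi * mob a z)),
           psi a = a &
           (forall z, disk z -> iter N psi z = z)]) /\
  (forall (H2 : N = 2%N),
     (exists a : Cx R, exists xi : Cx R,
       [/\ disk a, xi ^+ N = 1,
           (forall z, disk z -> psi z = mob (- a) (xi * mob a z)),
           psi a = a &
           (forall z, disk z -> iter N psi z = z)]) \/
     (exists Psi : Cx R -> Cx R,
       [/\ {within @cdisk R, continuous Psi},
           (forall z, disk z -> Psi z = psi z),
           (forall j, Psi (conjc (alpha j)) = conjc (alpha j)) &
           (forall z, cdisk z -> Psi z = z -> exists j, z = conjc (alpha j))])).
Proof.
move=> n3 fext _ lam0 alpha1 alphaI fE hpsi psiD fpsi.
have N0 : (0 < N)%N.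
  rewrite lt0n; apply/eqP => N0; apply: (extremal_not_cst (ltnW (ltnW n3)) fext (c := cexp (- 0))).
  move=> z z1; rewrite fE ?disk_md //; congr (cexp (- _)).
  by apply: big1 => j; have := ltn_ord j; rewrite [X in (_ < X)%N]N0.
have md_alpha j : md (alpha j) = 1 by apply/md1P.
have psi_d z : md z < 1 -> derivable psi z 1 by rewrite -disk_md; exact: hpsi.
have psi_1 z : md z < 1 -> md (psi z) < 1 by rewrite -!disk_md; exact: psiD.
(* The modulus of [f] is the exponential of minus the real part of the sum, and the real exponential
   is injective. *)
have Re_psi z : md z < 1 ->
    complex.Re (herglotz_sum lam alpha xpredT (psi z)) = complex.Re (herglotz_sum lam alpha xpredT z).
  move=> z1; have z1' : disk z by rewrite disk_md.
  have := congr1 (fun x => md x) (fpsi z z1'); rewrite !fE //; last exact: psiD.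
  by rewrite /= !md_cexp !ReN => /expR_inj /oppr_inj.
have [s [s_inj s_lim s_eq]] := psi_permutes_poles lam0 md_alpha alphaI psi_d psi_1 Re_psi N0.
(* The relation at a single index already determines [psi] as a rotated Moebius map. *)
have [tau tau0 htau] := s_eq (Ordinal N0).
have [kappa [b [k1 b1 hmob]]] := herglotz_eq_mob (md_alpha (Ordinal N0)) (md_alpha (s (Ordinal N0)))
  (lam0 (Ordinal N0)) (lam0 (s (Ordinal N0))) tau0.
have psiE z : md z < 1 -> psi z = kappa * mob b z.
  by move=> z1; apply: hmob (htau z z1) => //; exact: psi_1.
pose p j : Cx R := conjc (alpha j).
have p1 j : md (p j) = 1 by rewrite mdJ.
have p_inj : injective p by move=> i j /(can_inj (@conjcK R)) /alphaI.
(* Both sides are limits of [psi] at [p j]: one by continuity of the Moebius formula, the other by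
   [s_lim]. They are compared at a point [z] on the radius, within a distance that makes both errors
   less than half of the supposed gap [m]. *)
have psi_p j : kappa * mob b (p j) = p (s j).
  apply/eqP; rewrite -subr_eq0 -md_eq0; apply/negPn/negP => m0.
  set m := md _ in m0; have {}m0 : 0 < m by rewrite lt_neqAle eq_sym m0 md_ge0.
  have m2 : 0 < m / 2 by rewrite divr_gt0.
  have dm : derivable (fun z => kappa * mob b z : Cx R) (p j) 1.
    apply: (@derivableM (Cx R) (Cx R) (fun=> _) _ (p j) 1); first exact: derivable_cst.
    by apply: derivable_mob; rewrite ?p1.
  have [d1 d10 h1] := ex1_small (derivable_ex1 dm) m2.
  have [d2 d20 h2] := s_lim j _ m2.
  pose d := Num.min 1 (Num.min d1 d2); have d0 : 0 < d by rewrite !lt_min ltr01 d10.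
  have [da [db dc]] : d <= 1 /\ d <= d1 /\ d <= d2 by rewrite !ge_min !lexx !orbT.
  pose z : Cx R := (1 - d / 2)%:C * p j.
  have z1 : md z < 1 by rewrite mdM mdR p1 mulr1 ger0_norm; lra.
  have zd : md (z - p j) < d.
    have -> : z - p j = (- (d / 2))%:C * p j by rewrite /z rmorphB rmorphN rmorph1 /=; ring.
    by rewrite mdM p1 mulr1 mdR normrN ger0_norm; lra.
  have := h1 z (lt_le_trans zd db); rewrite -psiE // => A.
  have B := h2 z z1 (lt_le_trans zd dc).
  have := mdD (kappa * mob b (p j) - psi z) (psi z - p (s j)).
  rewrite addrA subrK [md (_ - psi z)]mdBC -/m.
  by move: A B; rewrite -/(p (s j)); lra.
split; first exact: (rotated_mob_is_aut k1 b1 psiE hpsi).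
split; first exact: (elliptic_of_ge3 k1 b1 p1 p_inj s_inj psiE psi_p).
exact: (elliptic_or_hyperbolic k1 b1 p1 p_inj s_inj psiE psi_p).
Qed.
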